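(* Let $n\geq 3$ and let $R\geq\sqrt{3}$. Then the cylinder $$\mathrm{Z}^{2n}(1)=\{(x_1,y_1,\ldots,x_n,y_n)\in\mathbb{R}^{2n} : x_1^2+y_1^2<1\}$$ admits a symplectic embedding into the product $\mathrm{B}^4(R)\times\mathbb{R}^{2(n-2)}$.
   Context: $\mathbb{R}^{2m}$, with coordinates $(x_1,y_1,\ldots,x_m,y_m)$, carries the standard symplectic form $\sum_{i=1}^m \mathrm{d}x_i\wedge \mathrm{d}y_i$. For $R>0$, $\mathrm{B}^{2m}(R)$ denotes the open ball $\{\sum_{i=1}^m x_i^2+y_i^2<R^2\}\subset\mathbb{R}^{2m}$. A smooth embedding between open subsets of $\mathbb{R}^{2n}$ is symplectic if it pulls back the standard symplectic form to itself. Here $\mathrm{B}^4(R)\times\mathbb{R}^{2(n-2)}$ is regarded as an open subset of $\mathbb{R}^{2n}$. *)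

(* Defs.v *)
From HB Require Import structures.
From mathcomp Require Import all_boot all_order all_algebra.
From mathcomp Require Import all_classical all_reals all_analysis.
Set Implicit Arguments. Unset Strict Implicit. Unset Printing Implicit Defensive.
Import Order.TTheory GRing.Theory Num.Theory.
Import numFieldNormedType.Exports.
Local Open Scope classical_set_scope.
Local Open Scope ring_scope.

(* Points of R^m are row vectors 'rV[R]_m.  [coord p k] is the k-th
   coordinate (0-based), and 0 if k is out of range.  In R^{2n} with
   coordinates (x_1,y_1,...,x_n,y_n), x_{i+1} = coord p (2 i) and
   y_{i+1} = coord p (2 i + 1). *)
Definition coord (R : realType) (m : nat) (p : 'rV[R]_m) (k : nat) : R :=
  match @insub nat (fun k => (k < m)%N) 'I_m k with
  | Some i => p ord0 i
  | None => 0
  end.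

Definition omega (R : realType) (n : nat) (u v : 'rV[R]_(n.*2)) : R :=
  \sum_(i < n) (coord u i.*2 * coord v i.*2.+1 - coord u i.*2.+1 * coord v i.*2).

Definition cylinder (R : realType) (n : nat) : set 'rV[R]_(n.*2) :=
  [set p | coord p 0 ^+ 2 + coord p 1 ^+ 2 < 1].

Definition ball4_prod (R : realType) (n : nat) (Rad : R) : set 'rV[R]_(n.*2) :=
  [set p | coord p 0 ^+ 2 + coord p 1 ^+ 2 + coord p 2 ^+ 2 + coord p 3 ^+ 2
           < Rad ^+ 2].

Fixpoint iter_dir (R : realType) (m : nat) (vs : seq 'rV[R]_m)
    (f : 'rV[R]_m -> 'rV[R]_m) : 'rV[R]_m -> 'rV[R]_m :=
  match vs with
  | [::] => f
  | v :: vs' => fun x => 'D_v (iter_dir vs' f) x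
  end.

(* C^infinity on U: every iterated directional derivative of f is
   (Frechet) differentiable at every point of U (hence all are continuous). *)
Definition smooth_on (R : realType) (m : nat) (U : set 'rV[R]_m)
    (f : 'rV[R]_m -> 'rV[R]_m) : Prop :=
  forall vs : seq 'rV[R]_m, forall x, U x -> differentiable (iter_dir vs f) x.

Definition symplectic_embedding (R : realType) (n : nat)
    (U V : set 'rV[R]_(n.*2)) (f : 'rV[R]_(n.*2) -> 'rV[R]_(n.*2)) : Prop :=
  [/\ smooth_on U f,
      (forall x y, U x -> U y -> f x = f y -> x = y),
      f @` U `<=` V,
      (exists g : 'rV[R]_(n.*2) -> 'rV[R]_(n.*2),
          (forall x, U x -> g (f x) = x) /\ {within f @` U, continuous g}) &
      (forall x, U x -> forall u v : 'rV[R]_(n.*2),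
          omega ('d f x u) ('d f x v) = omega u v)].

(* Main.v *)
(** The cylinder is [D x R^2 x R^2] with [D] the unit disc. After elementary area preserving
    maps its coordinates are [(a, b)] in a square, [(xi, t)] in a half-strip and [(s, w)]
    with [0 < s < 1]. Following Guth and Hind-Kerman, the half-strip is wound infinitely
    often along an immersed thin loop of the second plane, described in action-angle
    coordinates [(A2, theta2)] by an ellipse of centre [A2 = 1] and half-axis almost 1 in
    the direction of [A2]:
    - on one half of each loop a shear by [gamma(U) w] adds 1 to [s], so that different laps
      are told apart by the third plane; this spreads the strip over all angles [theta2],
      but only for [A2] very close to 1;
    - on the other half, which has to cross this annulus, [A1] is displaced by a tent
      function of height almost 1 in [A2], generated by [b]; since the tent has slope at
      most 1, the sweep in [theta2] is shorter than a full turn, and [A1 + A2 < 3].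
    The room left for all roundings at a point is governed by its distance to the boundary
    of [D]. A preliminary twist makes [xi] large when this distance is small, and the loops
    become thinner as [xi] grows, so that no room is lost and the radius [sqrt 3] is
    reached. The inverse is continuous by the inverse function theorem. *)

From Pilot Require Import Defs.
From HB Require Import structures.
From mathcomp Require Import all_boot all_order all_algebra.
From mathcomp Require Import all_classical all_reals all_analysis.
From mathcomp Require Import ring lra zify.
Import Order.TTheory GRing.Theory Num.Theory.
Import numFieldNormedType.Exports.
Local Open Scope classical_set_scope.
Local Open Scope ring_scope.
Import Pilot.Defs.

Set Implicit Arguments.
Unset Strict Implicit.
Unset Printing Implicit Defensive.

(** * Germs of smooth functions *)

Section germs.
Context {R : realType}.
Implicit Types V W : normedModType R.

(** Projected to the second plane, different laps overlap heavily, so injectivity has to come from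
    elsewhere. The shifted third-plane coordinate [sigma] survives in the image; with [A2] it
    determines [U], and two preimages can then differ only by lap, half and a multiple of pi in
    [theta2] (pi is a full turn, since the Cartesian angle is doubled). This fixes the exponents:
    laps are counted by xi^4, so the radius 1/xi times the fourth root of [sigma] is almost 1, and
    the stretching factor is a function of [sigma] alone. The dangerous encounter is an inner half,
    which carries the tent, with the sheared piece of an outer half. There |u| <= e = (k-1)^(-1/4),
    the tent has height at least 1 - 4e, and e <= 2/xi: a margin 8/xi in [a] separates the two in
    [A1]. Elsewhere the angle separates them: an added turn o(u) >= |K'(u) b| keeps the inner half
    at angles at most 0 and the outer half at positive ones, and the same margin 8/xi, now for [b],
    keeps the difference above -pi. *)

Lemma differentiable_near0 V W (h : V -> W) x :
  (\forall y \near x, h y = 0) -> differentiable h x.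
Proof.
move=> h0; have hx : h x = 0 by exact: nbhs_singleton h0.
have hs : h \o shift x = cst (h x) + (\0 : {linear V -> W}) +o_ (0 : V) id.
  apply/eqaddoP => _/posnumP[e].
  have : \forall y \near x, `|h y| <= 0 by apply: filterS h0 => y ->; rewrite normr0.
  rewrite (near_shift 0) subr0 => {}h0; near=> y.
  rewrite (@le_trans _ _ 0) ?mulr_ge0//.
  have -> : (h \o shift x - (cst (h x) + (\0 : {linear V -> W}) : V -> W)) y
      = (h \o shift x) y.
    by rewrite !fctE /= hx add0r subr0.
  by near: y.
have c0 : continuous (\0 : {linear V -> W}) by exact: cst_continuous.
apply/diff_locallyP; rewrite (diff_unique c0 hs); split => //.
Unshelve. all: by end_near. Qed.

(** Writing g = f + (g - f) reduces locality to a summand that vanishes near [x]. *)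
Lemma near_eq_differentiable V W (f g : V -> W) x :
  (\forall y \near x, f y = g y) -> differentiable f x -> differentiable g x.
Proof.
move=> fg df; rewrite (_ : g = f + (g - f)); last by rewrite addrC subrK.
apply: differentiableD => //; apply: differentiable_near0.
by near=> y; rewrite !fctE (near fg y)// subrr.
Unshelve. all: by end_near. Qed.

Lemma near_eq_diff V W (f g : V -> W) x :
  (\forall y \near x, f y = g y) -> differentiable f x ->
  'd f x = 'd g x :> (V -> W).
Proof.
move=> fg df; apply/funext => v; rewrite -!deriveE//.
  exact: near_eq_derive.
exact: near_eq_differentiable df.
Qed.

(** [smk k f x]: all iterated directional derivatives of [f] of order less than [k]
    are differentiable in a neighbourhood of [x]. *)
Fixpoint smk V (k : nat) (f : V -> R) (x : V) : Prop :=
  if k is k'.+1 then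
    (\forall y \near x, differentiable f y) /\
    forall v, smk k' (fun y => 'D_v f y) x
  else True.

Lemma smk_ext V k (f g : V -> R) x :
  (\forall y \near x, f y = g y) -> smk k f x -> smk k g x.
Proof.
elim: k f g => //= k IH f g /near_join fg [df Df]; split.
  near=> y; apply: (@near_eq_differentiable _ _ f); last exact: (near df y).
  exact: (near fg y).
move=> v; apply: IH (Df v); near=> y; apply: near_eq_derive.
exact: (near fg y).
Unshelve. all: by end_near. Qed.

Lemma smkS V k (f : V -> R) x : smk k.+1 f x -> smk k f x.
Proof.
by elim: k f => //= k IH f [df Df]; split => // v; apply: IH; exact: Df.
Qed.

Lemma smk_diff V k (f : V -> R) x : smk k.+1 f x -> differentiable f x.
Proof. by case=> + _; exact: nbhs_singleton. Qed.

Lemma smk_cst V k (c : R) (x : V) : smk k (fun=> c) x.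
Proof.
elim: k c => //= k IH c; split; first by near=> y; exact: differentiable_cst.
move=> v; apply: (@smk_ext _ _ (fun=> 0)); last exact: IH.
by near=> y; rewrite -[RHS]/('D_v (cst c) y) derive_cst.
Unshelve. all: by end_near. Qed.

Lemma smkD V k (f g : V -> R) x : smk k f x -> smk k g x ->
  smk k (fun y => f y + g y) x.
Proof.
elim: k f g => //= k IH f g [df Df] [dg Dg]; split.
  near=> y; apply: differentiableD; [exact: (near df y)|exact: (near dg y)].
move=> v; apply: smk_ext (IH _ _ (Df v) (Dg v)); near=> y.
rewrite -deriveD//; apply: diff_derivable; [exact: (near df y)|exact: (near dg y)].
Unshelve. all: by end_near. Qed.

Lemma smkM V k (f g : V -> R) x : smk k f x -> smk k g x ->
  smk k (fun y => f y * g y) x.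
Proof.
elim: k f g => //= k IH f g [df Df] [dg Dg]; split.
  near=> y; apply: differentiableM; [exact: (near df y)|exact: (near dg y)].
have Sf : smk k f x by apply: smkS; split.
have Sg : smk k g x by apply: smkS; split.
move=> v; apply: smk_ext (smkD (IH _ _ Sf (Dg v)) (IH _ _ Sg (Df v))).
near=> y; rewrite [in RHS]deriveM//; apply: diff_derivable;
  [exact: (near df y)|exact: (near dg y)].
Unshelve. all: by end_near. Qed.

Lemma diff_scale1 (g : R -> R) (z c : R) : differentiable g z ->
  'd g z c = c * 'D_1 g z.
Proof.
move=> dg; rewrite deriveE//.
have -> : 'd g z c = 'd g z (c *: (1 : R)) by congr ('d g z _); exact/esym/mulr1.
by rewrite linearZ.
Qed.

Lemma derive_comp1 V (g : R -> R) (f : V -> R) y v :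
  differentiable f y -> differentiable g (f y) ->
  'D_v (g \o f) y = 'D_v f y * 'D_1 g (f y).
Proof.
move=> df dg; have dgf := differentiable_comp df dg.
transitivity ('d (g \o f) y v); first exact: deriveE.
rewrite diff_comp//= diff_scale1//; congr (_ * _); exact/esym/deriveE.
Qed.

Lemma smk_comp1 V k (g : R -> R) (f : V -> R) x :
  smk k g (f x) -> smk k f x -> smk k (g \o f) x.
Proof.
elim: k g f => //= k IH g f [dg Dg] [df Df].
have fx : {for x, continuous f}.
  by apply: differentiable_continuous; exact: nbhs_singleton df.
have dgf : \forall y \near x, differentiable g (f y) by exact: fx dg.
split.
  by near=> y; apply: differentiable_comp; [exact: (near df y)|exact: (near dgf y)].
have Sf : smk k f x by apply: smkS; split.
move=> v; apply: smk_ext (smkM (Df v) (IH _ _ (Dg 1) Sf)); near=> y => /=.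
have dfy : differentiable f y by exact: (near df y).
have dgy : differentiable g (f y) by exact: (near dgf y).
exact/esym/derive_comp1.
Unshelve. all: by end_near. Qed.

(** In one variable the derivative along [v] is [v * h y], so one order of smoothness is gained.
    This drives the inductions for exp, sin, the inverse, the square root and [flat]. *)
Lemma smk_primitive k (g h : R -> R) (x : R) :
  (\forall y \near x, is_derive (y : R) (1 : R) g (h y)) -> smk k h x -> smk k.+1 g x.
Proof.
move=> gh hx; have dg : \forall y \near x, differentiable g y.
  by apply: filterS gh => y [] /derivable1_diffP.
split => // v; apply: smk_ext (smkM (smk_cst k v x) hx); near=> y.
have dgy : differentiable g y by exact: (near dg y).
transitivity (v * 'D_1 g y).
  by congr (_ * _); apply/esym/derive_val; exact: (near gh y).
transitivity ('d g y v); first exact/esym/diff_scale1.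
exact/esym/deriveE.
Unshelve. all: by end_near. Qed.

End germs.

(** * Vector-valued germs, and a calculus of explicit differentials *)

Section maps.
Context {R : realType}.
Implicit Types V W : normedModType R.

Lemma smk_sum V k (I : finType) (f : I -> V -> R) x :
  (forall i, smk k (f i) x) -> smk k (fun y => \sum_i f i y) x.
Proof.
move=> fk; rewrite (_ : (fun _ => _) = \sum_i f i); last first.
  by apply/funext => y; rewrite fct_sumE.
elim/big_ind : _ => //; first exact: smk_cst.
by move=> g h; exact: smkD.
Qed.

(** Smoothness is imposed coordinate by coordinate, so that the scalar product and chain rules of
    [smk] apply. *)
Definition smv V p (F : V -> 'rV[R]_p) (x : V) :=
  forall i k, smk k (fun y => F y ord0 i) x.

Lemma differentiable_coords V p (F : V -> 'rV[R]_p) (x : V) :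
  (forall i, differentiable (fun y => F y ord0 i) x) -> differentiable F x.
Proof.
move=> dF.
rewrite (_ : F = \sum_(i < p) (fun y => F y ord0 i *: delta_mx ord0 i)).
  by apply: differentiable_sum => i; exact: differentiableZl.
by apply/funext => y; rewrite fct_sumE; exact: row_sum_delta.
Qed.

Lemma near_differentiable_coords V p (F : V -> 'rV[R]_p) (x : V) :
  (forall i, \forall y \near x, differentiable (fun z => F z ord0 i) y) ->
  \forall y \near x, differentiable F y.
Proof.
move=> dF; have : \forall y \near x, forall i, differentiable (fun z => F z ord0 i) y.
  exact: filter_forall.
by apply: filterS => y; exact: differentiable_coords.
Qed.

Lemma smv_near_diff V p (F : V -> 'rV[R]_p) (x : V) : smv F x ->
  \forall y \near x, differentiable F y.
Proof.
by move=> SF; apply: near_differentiable_coords => i; have [] := SF i 1.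
Qed.

Lemma smv_diff V p (F : V -> 'rV[R]_p) (x : V) : smv F x -> differentiable F x.
Proof. by move/smv_near_diff; exact: nbhs_singleton. Qed.

Lemma derive_coord V p (F : V -> 'rV[R]_p) (x v : V) i : differentiable F x ->
  ('D_v F x) ord0 i = 'D_v (fun y => F y ord0 i) x.
Proof. by move=> dF; rewrite derive_mx ?mxE//; exact: diff_derivable. Qed.

Lemma derive_compv V p (g : 'rV[R]_p -> R) (F : V -> 'rV[R]_p) y v :
  differentiable F y -> differentiable g (F y) ->
  'D_v (g \o F) y =
  \sum_i 'D_v (fun z => F z ord0 i) y * 'D_(delta_mx ord0 i) g (F y).
Proof.
move=> dF dg; have dgF := differentiable_comp dF dg.
transitivity ('d (g \o F) y v); first exact: deriveE.
rewrite diff_comp//= -(deriveE _ dF) [X in 'd g _ X]row_sum_delta linear_sum/=.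
apply: eq_bigr => i _; rewrite linearZ/=; congr (_ * _).
  exact: derive_coord.
exact/esym/deriveE.
Qed.

(** Induction on the order: by the chain rule each directional derivative is a finite sum of
    products whose factors have one order less. *)
Lemma smk_compv V p k (g : 'rV[R]_p -> R) (F : V -> 'rV[R]_p) (x : V) :
  smk k g (F x) -> (forall i, smk k (fun y => F y ord0 i) x) ->
  smk k (g \o F) x.
Proof.
elim: k g F => // k IH g F [dg Dg] SF.
have dF : \forall y \near x, differentiable F y.
  by apply: near_differentiable_coords => i; have [] := SF i.
have Fx : {for x, continuous F}.
  by apply: differentiable_continuous; exact: nbhs_singleton dF.
have dgF : \forall y \near x, differentiable g (F y) by exact: Fx dg.
split.
  by near=> y; apply: differentiable_comp; [exact: (near dF y)|exact: (near dgF y)].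
move=> v; apply: (@smk_ext _ _ _ (fun y => \sum_i 'D_v (fun z => F z ord0 i) y *
    ((fun z => 'D_(delta_mx ord0 i) g z) \o F) y)).
  near=> y; apply/esym/derive_compv; [exact: (near dF y)|exact: (near dgF y)].
apply: smk_sum => i; apply: smkM; first by have [_] := SF i; exact.
by apply: IH => [|j]; [exact: Dg|apply: smkS; exact: SF].
Unshelve. all: by end_near. Qed.

Lemma smv_comp V p q (G : 'rV[R]_p -> 'rV[R]_q) (F : V -> 'rV[R]_p) (x : V) :
  smv F x -> smv G (F x) -> smv (G \o F) x.
Proof.
move=> SF SG i k; apply: (@smk_compv _ _ _ (fun z => G z ord0 i)); first exact: SG.
by move=> j; exact: SF.
Qed.

Lemma smv_ext V p (F G : V -> 'rV[R]_p) (x : V) :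
  (\forall y \near x, F y = G y) -> smv F x -> smv G x.
Proof.
by move=> FG SF i k; apply: smk_ext (SF i k); apply: filterS FG => y ->.
Qed.

(** Near [x] directional derivatives may be taken coordinatewise, so [smv] passes to every iterated
    derivative. *)
Lemma smv_smooth_on p (U : set 'rV[R]_p) (f : 'rV[R]_p -> 'rV[R]_p) :
  (forall x, U x -> smv f x) -> smooth_on U f.
Proof.
move=> Sf vs x Ux; apply: smv_diff; elim: vs => [|v vs IH] /=; first exact: Sf.
move=> i k; have [_ /(_ v)] := IH i k.+1; apply: smk_ext.
by apply: filterS (smv_near_diff IH) => y dy; rewrite derive_coord.
Qed.

Lemma coordE p (x : 'rV[R]_p) k (kp : (k < p)%N) : coord x k = x ord0 (Ordinal kp).
Proof. by rewrite /coord insubT. Qed.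

Lemma coord_ge p (x : 'rV[R]_p) k : (p <= k)%N -> coord x k = 0.
Proof. by move=> pk; rewrite /coord insubF// ltnNge pk. Qed.

Lemma coord_inj p (x y : 'rV[R]_p) : (forall k, (k < p)%N -> coord x k = coord y k) ->
  x = y.
Proof.
move=> xy; apply/rowP => -[i ip]; have := xy i ip.
by rewrite !(coordE _ ip).
Qed.

(** [DS x f d]: [f] is smooth near [x] and has differential [d] at [x]. *)
Definition DS V (x : V) (f : V -> R) (d : V -> R) :=
  (forall k, smk k f x) /\ 'd f x = d :> (V -> R).

Definition D1 (x : R) (g : R -> R) (g' : R) := DS x g (fun u => u * g').

Lemma DS_smk V (x : V) f d k : DS x f d -> smk k f x.
Proof. by case. Qed.

Lemma DS_diff V (x : V) f d : DS x f d -> differentiable f x.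
Proof. by case=> /(_ 1) /smk_diff. Qed.

Lemma DS_eq V (x : V) f d e : DS x f d -> d =1 e -> DS x f e.
Proof. by move=> [sf df] de; split => //; rewrite df; apply/funext. Qed.

Lemma DS_ext V (x : V) f g d : (\forall y \near x, f y = g y) -> DS x f d -> DS x g d.
Proof.
move=> fg [sf df]; split; first by move=> k; exact: smk_ext (sf k).
by rewrite -df; apply/esym/near_eq_diff => //; exact: smk_diff (sf 1).
Qed.

Lemma DS_cst V (x : V) (c : R) : DS x (fun=> c) (fun=> 0).
Proof. by split; [move=> k; exact: smk_cst|rewrite diff_cst]. Qed.

Lemma smk_linear V (f : {linear V -> R}) k x : continuous f -> smk k f x.
Proof.
move=> cf; case: k => // k; split.
  by apply: nearW => y; exact: linear_differentiable.
move=> v; apply: smk_ext (smk_cst k (f v) x); apply: nearW => y.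
rewrite deriveE; last exact: linear_differentiable.
by rewrite diff_lin.
Qed.

Lemma DS_coord p (x : 'rV[R]_p) k : DS x (fun y => coord y k) (fun u => coord u k).
Proof.
have [kp|pk] := ltnP k p; last first.
  have E : (fun y : 'rV[R]_p => coord y k) = (fun=> 0).
    by apply/funext => y; rewrite coord_ge.
  by rewrite E; exact: DS_cst.
have @f : {linear 'rV[R]_p -> R}.
  by exists (fun N : 'rV[R]_p => N ord0 (Ordinal kp)); do 2![eexists];
     do ?[constructor]; rewrite ?mxE// => ? *; rewrite ?mxE//; move=> ?; rewrite !mxE.
have E : (fun y : 'rV[R]_p => coord y k) = f.
  by apply/funext => y; rewrite (coordE _ kp).
have cf : continuous f by exact: coord_continuous.
by rewrite E; split; [move=> i; exact: smk_linear|rewrite diff_lin].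
Qed.

Lemma DS_add V (x : V) f g d e : DS x f d -> DS x g e ->
  DS x (fun y => f y + g y) (fun u => d u + e u).
Proof.
move=> [sf df] [sg dg]; split; first by move=> k; exact: smkD.
transitivity ('d f x \+ 'd g x); last by rewrite df dg.
exact: diffD (smk_diff (sf 1)) (smk_diff (sg 1)).
Qed.

Lemma DS_mul V (x : V) f g d e : DS x f d -> DS x g e ->
  DS x (fun y => f y * g y) (fun u => f x * e u + g x * d u).
Proof.
move=> [sf df] [sg dg]; split; first by move=> k; exact: smkM.
transitivity (f x *: ('d g x : V -> R) + g x *: ('d f x : V -> R)); last by rewrite df dg.
exact: diffM (smk_diff (sf 1)) (smk_diff (sg 1)).
Qed.

Lemma DS_opp V (x : V) f d : DS x f d -> DS x (fun y => - f y) (fun u => - d u).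
Proof.
move=> /(DS_mul (DS_cst x (-1))) H.
apply: (@DS_ext _ _ (fun y => -1 * f y)).
  by apply: nearW => y; rewrite mulN1r.
by apply: DS_eq H _ => u; rewrite mulN1r mulr0 addr0.
Qed.

Lemma DS_sub V (x : V) f g d e : DS x f d -> DS x g e ->
  DS x (fun y => f y - g y) (fun u => d u - e u).
Proof. by move=> Hf Hg; apply: DS_add => //; exact: DS_opp. Qed.

Lemma DS_comp V (x : V) g f g' d : DS x f d -> D1 (f x) g g' ->
  DS x (fun y => g (f y)) (fun u => d u * g').
Proof.
move=> [sf df] [sg dg]; split; first by move=> k; exact: smk_comp1.
transitivity ('d g (f x) \o 'd f x); last by rewrite df dg.
exact: diff_comp (smk_diff (sf 1)) (smk_diff (sg 1)).
Qed.

Lemma D1P (x : R) g g' : (forall k, smk k g x) -> is_derive x (1 : R) g g' -> D1 x g g'.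
Proof.
move=> sg [_ dg]; split => //; apply/funext => u.
by rewrite diff_scale1 ?dg//; exact: smk_diff (sg 1).
Qed.

Lemma D1_is_derive (x : R) g g' : D1 x g g' -> is_derive x (1 : R) g g'.
Proof.
move=> H; have dg := DS_diff H; split; first exact/derivable1_diffP.
by rewrite deriveE//; case: H => _ ->; rewrite mul1r.
Qed.

Lemma D1_primitive (x : R) (g h : R -> R) :
  (\forall y \near x, is_derive (y : R) (1 : R) g (h y)) ->
  (forall k, smk k h x) -> D1 x g (h x).
Proof.
move=> gh sh; apply: D1P; last exact: nbhs_singleton gh.
by case=> // k; exact: smk_primitive gh (sh k).
Qed.

Lemma D1_id (x : R) : D1 x id 1.
Proof.
apply: (@D1_primitive _ _ (fun=> 1)) => [|k]; last exact: smk_cst.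
have H (y : R) : is_derive y (1 : R) (@id R) 1 by exact: is_derive_id.
exact: (@nearW _ (nbhs x) _ _ H).
Qed.

End maps.

(** * Symplectic germs *)

Section symplectic_germs.
Context {R : realType} (n : nat).
Local Notation E := 'rV[R]_(n.*2).

Definition symp_at (f : E -> E) (x : E) :=
  smv f x /\ forall u v, omega ('d f x u) ('d f x v) = omega u v.

Lemma symp_at_comp (f g : E -> E) x :
  symp_at f x -> symp_at g (f x) -> symp_at (g \o f) x.
Proof.
move=> [sf of_] [sg og]; split; first exact: smv_comp.
move=> u v; rewrite diff_comp; [|exact: smv_diff..].
by rewrite /= og of_.
Qed.

Lemma symp_at_ext (f g : E -> E) x :
  (\forall y \near x, f y = g y) -> symp_at f x -> symp_at g x.
Proof.
move=> fg [sf of_]; split; first exact: smv_ext sf.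
by move=> u v; rewrite -(near_eq_diff fg (smv_diff sf)).
Qed.

(** Every factor of the embedding acts on the first three planes only; the default value of [nth]
    keeps all further coordinates, so one formula serves every n. *)
Definition upd6 (p : E) (c0 c1 c2 c3 c4 c5 : R) : E :=
  \row_i nth (p ord0 i) [:: c0; c1; c2; c3; c4; c5] i.

Lemma coord_upd6 p c0 c1 c2 c3 c4 c5 k : (k < n.*2)%N ->
  coord (upd6 p c0 c1 c2 c3 c4 c5) k =
  nth (coord p k) [:: c0; c1; c2; c3; c4; c5] k.
Proof. by move=> kn; rewrite !(coordE _ kn) mxE. Qed.

Lemma smv_upd6 (c0 c1 c2 c3 c4 c5 : E -> R) x :
  (forall k, smk k c0 x) -> (forall k, smk k c1 x) -> (forall k, smk k c2 x) ->
  (forall k, smk k c3 x) -> (forall k, smk k c4 x) -> (forall k, smk k c5 x) ->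
  smv (fun p => upd6 p (c0 p) (c1 p) (c2 p) (c3 p) (c4 p) (c5 p)) x.
Proof.
move=> s0 s1 s2 s3 s4 s5 i k.
rewrite (_ : (fun _ => _) =
  (fun p => nth (coord p i) [:: c0 p; c1 p; c2 p; c3 p; c4 p; c5 p] i)); last first.
  by apply/funext => p; rewrite mxE (coordE _ (ltn_ord i)); congr (nth (p _ _)); apply: val_inj.
case: i => -[|[|[|[|[|[|i]]]]]] iP //=.
by under eq_fun do rewrite nth_nil; have [+ _] := DS_coord x i.+3.+3; exact.
Qed.

Lemma omega_split3 (u v : E) : (3 <= n)%N -> omega u v =
  coord u 0 * coord v 1 - coord u 1 * coord v 0 +
  (coord u 2 * coord v 3 - coord u 3 * coord v 2) +
  (coord u 4 * coord v 5 - coord u 5 * coord v 4) +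
  \sum_(3 <= i < n)
    (coord u i.*2 * coord v i.*2.+1 - coord u i.*2.+1 * coord v i.*2).
Proof.
move=> n3; rewrite /omega -(big_mkord xpredT (fun i =>
  (coord u i.*2 * coord v i.*2.+1 - coord u i.*2.+1 * coord v i.*2))).
have n2 := ltnW n3; have n1 := ltnW n2.
by rewrite (big_ltn n1) (big_ltn n2) (big_ltn n3) !addrA.
Qed.

(** The planes from the fourth on contribute equal terms to both sides, which leaves an identity
    between six explicit differentials, within reach of [ring] and [field]. *)
Lemma symp_at_upd6 (c0 c1 c2 c3 c4 c5 d0 d1 d2 d3 d4 d5 : E -> R) x :
  (3 <= n)%N ->
  DS x c0 d0 -> DS x c1 d1 -> DS x c2 d2 -> DS x c3 d3 -> DS x c4 d4 -> DS x c5 d5 ->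
  (forall u v, d0 u * d1 v - d1 u * d0 v + (d2 u * d3 v - d3 u * d2 v) +
     (d4 u * d5 v - d5 u * d4 v) =
     coord u 0 * coord v 1 - coord u 1 * coord v 0 +
     (coord u 2 * coord v 3 - coord u 3 * coord v 2) +
     (coord u 4 * coord v 5 - coord u 5 * coord v 4)) ->
  symp_at (fun p => upd6 p (c0 p) (c1 p) (c2 p) (c3 p) (c4 p) (c5 p)) x.
Proof.
move=> n3 D0 D1 D2 D3 D4 D5 H.
set f := (fun p => _).
have sf : smv f x by apply: smv_upd6 => k; apply: DS_smk; eassumption.
have df := smv_diff sf.
have E6 k u : (k < n.*2)%N -> coord ('d f x u) k =
    nth (coord u k) [:: d0 u; d1 u; d2 u; d3 u; d4 u; d5 u] k.
  move=> kn; rewrite (coordE _ kn) -deriveE// derive_coord//.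
  rewrite (_ : (fun _ => _) =
    (fun p => nth (coord p k) [:: c0 p; c1 p; c2 p; c3 p; c4 p; c5 p] k)); last first.
    by apply/funext => p; rewrite -(coordE _ kn) coord_upd6.
  have DSE c d : DS x c d -> 'D_u c x = d u.
    move=> Dc; transitivity ('d c x u); first exact/deriveE/(DS_diff Dc).
    by case: Dc => _ ->.
  case: k kn => [|[|[|[|[|[|k]]]]]] kn /=;
    [exact: DSE..|under eq_fun do rewrite nth_nil; rewrite nth_nil].
  by apply: (DSE _ (fun u => coord u k.+3.+3)); exact: DS_coord.
split => // u v; rewrite !omega_split3//.
have n6 k : (k < 6)%N -> (k < n.*2)%N.
  by move=> k6; apply: leq_trans k6 _; rewrite (@leq_double 3).
rewrite !E6 ?n6//= H; congr (_ + _); apply: eq_big_nat => i /andP[i3 iN].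
have i2 : (i.*2 < n.*2)%N by rewrite ltn_double.
have i21 : (i.*2.+1 < n.*2)%N by rewrite ltn_Sdouble.
have d6 : (6 <= i.*2)%N by rewrite (@leq_double 3).
by rewrite !E6// !nth_default//= ltnW.
Qed.

End symplectic_germs.

(** * One-variable profiles *)

Section elementary_functions.
Context {R : realType}.

Lemma DS_pow (V : normedModType R) (x : V) f d m : DS x f d ->
  DS x (fun y => f y ^+ m) (fun u => m%:R * f x ^+ m.-1 * d u).
Proof.
move=> Df; elim: m => [|m IH].
  rewrite (_ : (fun _ => _) = (fun=> 1)); last by apply/funext => y; rewrite expr0.
  by apply: DS_eq (DS_cst x 1) _ => u; rewrite !mul0r.
rewrite (_ : (fun _ => _) = (fun y => f y * f y ^+ m)); last first.
  by apply/funext => y; rewrite exprS.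
apply: DS_eq (DS_mul Df IH) _ => u.
case: m {IH} => [|m] /=; first by rewrite !expr0; ring.
by rewrite exprS (mulrSr 1 m.+1); ring.
Qed.

Implicit Types (x y z : R) (k : nat).

Lemma smk_expR k x : smk k (@expR R) x.
Proof.
elim: k => // k IH; apply: smk_primitive IH.
by apply: (@nearW _ (nbhs x) _ _) => y; exact: is_derive_expR.
Qed.

Lemma D1_expR x : D1 x expR (expR x).
Proof. by apply: D1P => k; exact: smk_expR. Qed.

Lemma smk_sin_cos k x : smk k (@sin R) x /\ smk k (@cos R) x.
Proof.
elim: k => // k [IHs IHc]; split; apply: smk_primitive.
- by apply: (@nearW _ (nbhs x) _ _) => y; exact: is_derive_sin.
- by [].
- by apply: (@nearW _ (nbhs x) _ _) => y; exact: is_derive_cos.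
- apply: (@smk_ext _ _ _ (fun y => -1 * sin y)).
    by apply: (@nearW _ (nbhs x) _ _) => y; rewrite mulN1r.
  by apply: smkM => //; exact: smk_cst.
Qed.

Lemma D1_sin x : D1 x sin (cos x).
Proof. by apply: D1P => k; case: (smk_sin_cos k x). Qed.

Lemma D1_cos x : D1 x cos (- sin x).
Proof. by apply: D1P => k; case: (smk_sin_cos k x). Qed.

Lemma is_derive_inv x : x != 0 -> is_derive x (1 : R) (fun y : R => y^-1) (- x ^- 2).
Proof.
move=> x0; have := @is_deriveV R id x 1 1 x0 (is_derive_id _ _).
by move/is_derive_eq; apply; rewrite [_ *: _]mulr1.
Qed.

Lemma near_neq0 x : x != 0 -> \forall y \near x, y != 0.
Proof.
move=> x0; have := x0; rewrite neq_lt => /orP[xn|xp].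
  by apply: filterS (lt_nbhsl xn) => y; exact: ltr0_neq0.
by apply: filterS (lt_nbhsr xp) => y; exact: lt0r_neq0.
Qed.

Lemma smk_inv k x : x != 0 -> smk k (fun y : R => y^-1) x.
Proof.
move=> x0; elim: k => // k IH.
apply: (@smk_primitive _ _ _ (fun y => -1 * (y^-1 * y^-1))).
  apply: filterS (near_neq0 x0) => y y0; rewrite mulN1r -invfM -expr2.
  exact: is_derive_inv.
by apply: smkM; [exact: smk_cst|exact: smkM].
Qed.

Lemma D1_inv x : x != 0 -> D1 x (fun y => y^-1) (- x ^- 2).
Proof. by move=> x0; apply: D1P => [k|]; [exact: smk_inv|exact: is_derive_inv]. Qed.

Lemma smk_sqrt k x : 0 < x -> smk k (@Num.sqrt R) x.
Proof.
move=> x0; elim: k => // k IH.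
apply: (@smk_primitive _ _ _ (fun y => (2 * Num.sqrt y)^-1)).
  by apply: filterS (lt_nbhsr x0) => y y0; exact: is_derive1_sqrt.
apply: (@smk_comp1 _ _ k (fun y => y^-1) (fun y => 2 * Num.sqrt y)).
  by apply: smk_inv; rewrite mulf_neq0// gt_eqF// sqrtr_gt0.
by apply: smkM => //; exact: smk_cst.
Qed.

Lemma D1_sqrt x : 0 < x -> D1 x Num.sqrt (2 * Num.sqrt x)^-1.
Proof. by move=> x0; apply: D1P => [k|]; [exact: smk_sqrt|exact: is_derive1_sqrt]. Qed.

(** The functions z^(-j) e^(-1/z), extended by 0. With the index [j] the family is closed under
    differentiation ([is_derive_flat]), so that smoothness follows by induction. *)
Definition flat (j : nat) (z : R) : R :=
  if 0 < z then z^-1 ^+ j * expR (- z^-1) else 0.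

Lemma flat_gt0 j z : 0 < z -> 0 < flat j z.
Proof. by move=> z0; rewrite /flat z0 mulr_gt0 ?expR_gt0// exprn_gt0// invr_gt0. Qed.

Lemma flat_le0 j z : z <= 0 -> flat j z = 0.
Proof. by move=> z0; rewrite /flat ltNge z0. Qed.

Lemma flat_ge0 j z : 0 <= flat j z.
Proof. by have [/(flat_gt0 j)/ltW//|/(flat_le0 j)->] := ltP 0 z. Qed.

Lemma flatSr j z : flat j z = flat j.+1 z * z.
Proof.
have [z0|z0] := ltP 0 z; last by rewrite !flat_le0// mul0r.
by rewrite /flat z0 exprS; field; rewrite gt_eqF.
Qed.

(** The exponential of 1/z dominates the term of order j+1 of its series, and [flatSr] splits off
    one factor z. *)
Lemma flat_bound j z : `|flat j z| <= j.+1`!%:R * `|z|.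
Proof.
rewrite ger0_norm ?flat_ge0//; have [z0|z0] := ltP 0 z; last first.
  by rewrite flat_le0// mulr_ge0.
rewrite gtr0_norm// flatSr ler_pM2r//.
have zi : 0 <= z^-1 by rewrite invr_ge0 ltW.
have := expR_ge1Dxn j zi.
rewrite /flat z0 expRN => H; rewrite ler_pdivrMr ?expR_gt0// -ler_pdivrMl ?ltr0n ?fact_gt0//.
by rewrite mulrC (le_trans _ H)// lerDr.
Qed.

Lemma flat_continuous0 j : {for 0, continuous (flat j)}.
Proof.
rewrite /prop_for /continuous_at flat_le0//; apply/cvgr0Pnorm_le => e e0.
have d0 : 0 < e / j.+1`!%:R by rewrite divr_gt0// ltr0n fact_gt0.
near=> z; rewrite (le_trans (flat_bound j z))// mulrC -ler_pdivlMr ?ltr0n ?fact_gt0//.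
Unshelve. all: by end_near. Qed.

Lemma D1_ext x f g d : (\forall y \near x, f y = g y) -> D1 x f d -> D1 x g d.
Proof. exact: DS_ext. Qed.

Lemma is_derive_flat j z :
  is_derive z (1 : R) (flat j) (flat j.+2 z - j%:R * flat j.+1 z).
Proof.
have [z0|z0|<-] := ltgtP 0 z.
- apply: D1_is_derive.
  apply: (@D1_ext _ (fun y => y^-1 ^+ j * expR (- y^-1))).
    by apply: filterS (lt_nbhsr z0) => y y0; rewrite /flat y0.
  have zN0 : z != 0 by rewrite gt_eqF.
  apply: DS_eq.
    apply: DS_mul; first exact/DS_pow/D1_inv.
    exact: (DS_comp (DS_opp (D1_inv zN0)) (D1_expR _)).
  move=> u /=; rewrite /flat z0 -exprVn !exprS.
  by case: j => [|j] /=; rewrite ?exprS; ring.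
- rewrite !flat_le0 ?ltW// mulr0 subr0; apply: D1_is_derive.
  apply: (@D1_ext _ (fun=> 0)).
    by apply: filterS (lt_nbhsl z0) => y y0; rewrite flat_le0 ?ltW.
  by apply: DS_eq (DS_cst _ _) _ => u; rewrite mulr0.
(* At 0 the difference quotient of [flat j] is [flat j.+1] itself, by [flatSr], and it is continuous
   there with value 0. *)
- rewrite !flat_le0// mulr0 subr0; apply/is_derive1_caratheodory.
  exists (flat j.+1); split; last exact: flat_le0.
    by move=> y; rewrite (flat_le0 _ (lexx 0)) !subr0 -flatSr.
  exact: flat_continuous0.
Qed.

Lemma smk_flat k j z : smk k (flat j) z.
Proof.
elim: k j => // k IH j.
apply: (@smk_primitive _ _ _ (fun y => flat j.+2 y + (- j%:R) * flat j.+1 y)).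
  apply: (@nearW _ (nbhs z) _ _) => y; rewrite mulNr; exact: is_derive_flat.
by apply: smkD => //; apply: smkM => //; exact: smk_cst.
Qed.

Lemma D1_flat j z : D1 z (flat j) (flat j.+2 z - j%:R * flat j.+1 z).
Proof. by apply: D1P => [k|]; [exact: smk_flat|exact: is_derive_flat]. Qed.

Lemma flat_nondecreasing : {homo flat 0 : y z / y <= z}.
Proof.
move=> y z yz; have [y0|y0] := ltP 0 y; last by rewrite (flat_le0 _ y0) flat_ge0.
have z0 := lt_le_trans y0 yz.
by rewrite /flat y0 z0 !mul1r ler_expR lerN2 lef_pV2.
Qed.

(** This is 1 + 1/z <= e^(1/z). The sum is the derivative of z e^(-1/z), so the inequality is what
    caps the slope of [tent] at 1. *)
Lemma flat01_le1 z : flat 0 z + flat 1 z <= 1.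
Proof.
have [z0|z0] := ltP 0 z; last by rewrite !flat_le0// addr0.
rewrite /flat z0 mul1r expr1 -{1}[expR _]mul1r -mulrDl expRN.
by rewrite ler_pdivrMr ?expR_gt0// mul1r expR_ge1Dx.
Qed.

Definition step (z : R) : R := flat 0 z / (flat 0 z + flat 0 (1 - z)).

Definition dstep (z : R) : R :=
  (flat 2 z * flat 0 (1 - z) + flat 0 z * flat 2 (1 - z)) /
  (flat 0 z + flat 0 (1 - z)) ^+ 2.

Lemma step_den_gt0 z : 0 < flat 0 z + flat 0 (1 - z).
Proof.
have [z0|z0] := ltP 0 z.
  by rewrite ltr_pwDl ?flat_gt0 ?flat_ge0.
by rewrite ltr_wpDl ?flat_ge0// flat_gt0// subr_gt0 (le_lt_trans z0).
Qed.

Lemma step_le0 z : z <= 0 -> step z = 0.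
Proof. by move=> z0; rewrite /step flat_le0// mul0r. Qed.

Lemma step_ge1 z : 1 <= z -> step z = 1.
Proof.
move=> z1; rewrite /step (@flat_le0 0 (1 - z)) ?subr_le0// addr0 divff//.
by rewrite gt_eqF// flat_gt0// (lt_le_trans _ z1).
Qed.

Lemma step_nondecreasing : {homo step : y z / y <= z}.
Proof.
move=> y z yz; rewrite /step ler_pdivrMr ?step_den_gt0// mulrAC.
rewrite ler_pdivlMr ?step_den_gt0// !mulrDr mulrC lerD2l.
by rewrite ler_pM ?flat_ge0// flat_nondecreasing// lerB.
Qed.

Lemma step_ge0 z : 0 <= step z.
Proof. by rewrite divr_ge0 ?flat_ge0// ltW// step_den_gt0. Qed.

Lemma step_le1 z : step z <= 1.
Proof. by rewrite ler_pdivrMr ?step_den_gt0// mul1r lerDl flat_ge0. Qed.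

Lemma dstep_ge0 z : 0 <= dstep z.
Proof.
by rewrite divr_ge0 ?sqr_ge0// addr_ge0// mulr_ge0// flat_ge0.
Qed.

Lemma dstep_le0 z : z <= 0 -> dstep z = 0.
Proof. by move=> z0; rewrite /dstep !(flat_le0 _ z0) !mul0r addr0 mul0r. Qed.

Lemma dstep_ge1 z : 1 <= z -> dstep z = 0.
Proof.
move=> z1; have z0 : 1 - z <= 0 by rewrite subr_le0.
by rewrite /dstep !(flat_le0 _ z0) !mulr0 addr0 mul0r.
Qed.

Lemma D1_step z : D1 z step (dstep z).
Proof.
have den0 : flat 0 z + flat 0 (1 - z) != 0 by rewrite gt_eqF ?step_den_gt0.
have D1z : DS z (fun y => 1 - y) (fun u : R => 0 - u * 1).
  exact: (DS_sub (DS_cst _ 1) (D1_id z)).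
have Dden := DS_add (D1_flat 0 z)
  (DS_comp D1z (D1_flat 0 (1 - z))).
have H := DS_mul (D1_flat 0 z) (DS_comp Dden (D1_inv den0)).
apply: DS_eq H _; by move=> u /=; rewrite /dstep; field.
Qed.

Lemma smk_derive (V : normedModType R) (x : V) (g : V -> R) (v : V) :
  (forall k, smk k g x) -> forall k, smk k (fun y : V => 'D_v g y) x.
Proof. by move=> sg k; have [_] := sg k.+1; exact. Qed.

Lemma smk_dstep k z : smk k dstep z.
Proof.
rewrite (_ : dstep = (fun y => 'D_(1 : R) step y)).
  by apply: smk_derive => i; case: (D1_step z).
by apply/funext => y; have [_ ->] := D1_is_derive (D1_step y).
Qed.

Lemma D1_derive x (g : R -> R) : (forall k, smk k g x) -> D1 x g ('D_(1 : R) g x).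
Proof.
move=> sg; split => //; apply/funext => u.
by rewrite diff_scale1//; exact: smk_diff (sg 1).
Qed.

End elementary_functions.

(** * Profiles for the strips, the disc and the tent *)

Section profiles.
Context {R : realType}.
Implicit Types (x y z u e : R) (k : nat).

Lemma ge0_derive_ndecr (g h : R -> R) x y :
  (forall z, x < z < y -> is_derive z (1 : R) g (h z)) ->
  {within `[x, y], continuous g} ->
  (forall z, x < z < y -> 0 <= h z) -> x <= y -> g x <= g y.
Proof.
move=> gh gc h0; rewrite le_eqVlt => /predU1P[->//|xy].
have gh' z : z \in `]x, y[ -> is_derive z (1 : R) g (h z) by rewrite in_itv => /gh.
have [c cxy E] := @MVT R g h x y xy gh' gc.
rewrite -subr_ge0 E mulr_ge0 ?subr_ge0 ?(ltW xy)//.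
by apply: h0; move: cxy; rewrite in_itv.
Qed.

Lemma gt0_derive_incr (g h : R -> R) x y :
  (forall z, x <= z <= y -> is_derive z (1 : R) g (h z)) ->
  (forall z, x < z < y -> 0 < h z) -> x < y -> g x < g y.
Proof.
move=> gh h0 xy.
have gh' z : z \in `]x, y[ -> is_derive z (1 : R) g (h z).
  by rewrite in_itv => /andP[xz zy]; apply: gh; rewrite !ltW.
have gc : {within `[x, y], continuous g}.
  by apply: derivable_within_continuous => z; rewrite in_itv/= => /gh; case.
have [c cxy E] := @MVT R g h x y xy gh' gc.
rewrite -subr_gt0 E mulr_gt0 ?subr_gt0//.
by apply: h0; move: cxy; rewrite in_itv.
Qed.

Definition jap y : R := Num.sqrt (1 + y ^+ 2).

Lemma jap2_gt0 y : 0 < 1 + y ^+ 2.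
Proof. by rewrite ltr_wpDr ?sqr_ge0. Qed.

Lemma jap_gt0 y : 0 < jap y.
Proof. by rewrite sqrtr_gt0 jap2_gt0. Qed.

Lemma sqr_jap y : jap y ^+ 2 = 1 + y ^+ 2.
Proof. by rewrite sqr_sqrtr// ltW// jap2_gt0. Qed.

Lemma D1_jap y : D1 y jap (y / jap y).
Proof.
have H := DS_comp (DS_add (DS_cst y 1) (DS_pow 2 (D1_id y))) (D1_sqrt (jap2_gt0 y)).
apply: DS_eq H _ => u; rewrite -/(jap y).
by field; rewrite gt_eqF ?jap_gt0.
Qed.

(** An algebraic diffeomorphism of the line onto the unit interval; its derivative is the inverse of
    the factor used in [to_halfstrip] and [to_strip]. *)
Definition sg y : R := (1 + y / jap y) / 2.

Lemma D1_sg y : D1 y sg (2 * jap y ^+ 3)^-1.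
Proof.
have j0 : jap y != 0 by rewrite gt_eqF ?jap_gt0.
have H := DS_mul (DS_add (DS_cst y 1) (DS_mul (D1_id y)
  (DS_comp (D1_jap y) (D1_inv j0)))) (DS_cst y 2^-1).
apply: DS_eq H _ => u /=.
transitivity (u * (jap y ^+ 2 - y ^+ 2) / (2 * jap y ^+ 3)); first by field.
by rewrite sqr_jap addrK mulr1.
Qed.

Lemma norm_lt_jap y : `|y| < jap y.
Proof.
rewrite -ltr_sqr ?nnegrE ?normr_ge0 ?(ltW (jap_gt0 y))//.
by rewrite sqr_jap real_normK ?num_real// ltrDr.
Qed.

Lemma sg_gt0 y : 0 < sg y.
Proof.
have := norm_lt_jap y; rewrite ltr_norml => /andP[H _].
by rewrite divr_gt0// -(ltrD2l (-1)) addKr addr0 ltr_pdivlMr ?jap_gt0// mulN1r.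
Qed.

Lemma sg_lt1 y : sg y < 1.
Proof.
have := norm_lt_jap y; rewrite ltr_norml => /andP[_ H].
rewrite ltr_pdivrMr// mul1r (_ : 2 = 1 + 1)// ltrD2l.
by rewrite ltr_pdivrMr ?jap_gt0// mul1r.
Qed.

Lemma sg_inj : injective sg.
Proof.
have lt_sg x y : x < y -> sg x < sg y.
  apply: (@gt0_derive_incr _ (fun y => (2 * jap y ^+ 3)^-1)).
    by move=> z _; exact: D1_is_derive (D1_sg z).
  by move=> z _; rewrite invr_gt0 mulr_gt0// exprn_gt0// jap_gt0.
by move=> x y xy; apply/eqP; case: ltgtP => // /lt_sg; rewrite xy ltxx.
Qed.

Definition chord x : R := Num.sqrt (1 - x ^+ 2).

Lemma chord2_gt0 x : -1 < x < 1 -> 0 < 1 - x ^+ 2.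
Proof. by move=> /andP[x1 x2]; nra. Qed.

Lemma chord_gt0 x : -1 < x < 1 -> 0 < chord x.
Proof. by move=> H; rewrite sqrtr_gt0 chord2_gt0. Qed.

Lemma sqr_chord x : -1 < x < 1 -> chord x ^+ 2 = 1 - x ^+ 2.
Proof. by move=> H; rewrite sqr_sqrtr// ltW// chord2_gt0. Qed.

Lemma D1_chord x : -1 < x < 1 -> D1 x chord (- x / chord x).
Proof.
move=> H; have D := DS_comp (DS_sub (DS_cst x 1) (DS_pow 2 (D1_id x)))
  (D1_sqrt (chord2_gt0 H)).
apply: DS_eq D _ => u; rewrite -/(chord x).
by field; rewrite gt_eqF ?chord_gt0.
Qed.

(** Normalised area of the part of the unit disc to the left of abscissa [x]. *)
Definition area x : R := (x * chord x + asin x) / pi + 2^-1.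

Lemma is_derive_area x : -1 < x < 1 -> is_derive x (1 : R) area (2 * chord x / pi).
Proof.
move=> H; have c0 : chord x != 0 by rewrite gt_eqF ?chord_gt0.
have da := is_derive1_asin H.
have dc := D1_is_derive (D1_chord H).
have dp : is_derive x (1 : R) (fun y => y * chord y + asin y)
    (x * (- x / chord x) + chord x * 1 + (chord x)^-1).
  by apply: is_deriveD; apply: is_deriveM.
have dq : is_derive x (1 : R) (fun y => (y * chord y + asin y) * pi^-1)
    ((x * chord x + asin x) * 0 + pi^-1 * (2 * chord x)).
  have -> : 2 * chord x = x * (- x / chord x) + chord x * 1 + (chord x)^-1.
    transitivity (chord x + chord x ^+ 2 / chord x); first by field.
    by rewrite sqr_chord//; field.
  by apply: is_deriveM; exact: is_derive_cst.
have := is_deriveD dq (is_derive_cst (2^-1 : R) x (1 : R)).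
by move/is_derive_eq; apply; rewrite mulr0 add0r addr0 mulrC.
Qed.

Lemma near_m11 x : -1 < x < 1 -> \forall y \near x, -1 < y < 1.
Proof.
move=> /andP[x1 x2]; near=> y; apply/andP; split; near: y.
  exact: lt_nbhsr.
exact: lt_nbhsl.
Unshelve. all: by end_near. Qed.

Lemma D1_area x : -1 < x < 1 -> D1 x area (2 * chord x / pi).
Proof.
move=> H; apply: (@D1_primitive _ _ _ (fun x => 2 * chord x / pi)).
  by apply: filterS (near_m11 H) => y; exact: is_derive_area.
move=> k; apply: smkM; last exact: smk_cst.
by apply: smkM; [exact: smk_cst|case: (D1_chord H)].
Qed.

Lemma area_lt x y : -1 < x -> y < 1 -> x < y -> area x < area y.
Proof.
move=> x1 y1; apply: (@gt0_derive_incr _ (fun x => 2 * chord x / pi)) => z /andP[xz zy].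
  by apply: is_derive_area; rewrite (lt_le_trans x1)// (le_lt_trans zy).
by rewrite divr_gt0 ?pi_gt0// mulr_gt0// chord_gt0// (lt_trans x1)// (lt_trans zy).
Qed.

(** The difference has derivative 2 sin^2. Taken at asin x + pi/2 and at pi/2 - asin x, the
    inequality confines [area] to [0, 1]. *)
Lemma sin_cos_le z : 0 <= z -> sin z * cos z <= z.
Proof.
move=> z0; rewrite -subr_ge0.
have D (y : R) : is_derive y (1 : R) (fun y => y - sin y * cos y)
    (1 - (sin y * (- sin y) + cos y * cos y)).
  by apply: is_deriveB; apply: is_deriveM.
have := @ge0_derive_ndecr _ _ 0 z (fun y _ => D y) _ _ z0.
rewrite sin0 mul0r subr0; apply.
  by apply: derivable_within_continuous => y _; have [] := D y.
move=> y _; have := cos2Dsin2 y; have := sqr_ge0 (sin y); nra.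
Qed.

Lemma area_ge0 x : -1 < x < 1 -> 0 <= area x.
Proof.
move=> /andP[x1 x2]; have x11 : -1 <= x <= 1 by rewrite !ltW.
have h : 0 <= asin x + pi / 2 by have := asin_geNpi2 x11; lra.
have := sin_cos_le h.
rewrite sinDpihalf cosDpihalf asinK ?in_itv//= cos_asin// -/(chord x) => H.
rewrite /area -(@pmulr_lge0 _ pi) ?pi_gt0// mulrDl divfK ?gt_eqF ?pi_gt0//.
by move: H; lra.
Qed.

Lemma area_le1 x : -1 < x < 1 -> area x <= 1.
Proof.
move=> /andP[x1 x2]; have x11 : -1 <= x <= 1 by rewrite !ltW.
have h : 0 <= pi / 2 - asin x by have := asin_lepi2 x11; lra.
have := sin_cos_le h.
rewrite -opprB sinN cosN sinBpihalf cosBpihalf opprK asinK ?in_itv//= cos_asin//.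
rewrite -/(chord x) => H.
rewrite /area -(@ler_pM2r _ pi) ?pi_gt0// mulrDl divfK ?gt_eqF ?pi_gt0//.
by move: H; lra.
Qed.

Lemma area_lt1 x : -1 < x < 1 -> area x < 1.
Proof.
move=> /andP[x1 x2]; apply: (@lt_le_trans _ _ (area ((1 + x) / 2))).
  by apply: area_lt => //; lra.
by apply: area_le1; lra.
Qed.

Lemma area_gt0 x : -1 < x < 1 -> 0 < area x.
Proof.
move=> /andP[x1 x2]; apply: (@le_lt_trans _ _ (area ((x - 1) / 2))).
  by apply: area_ge0; lra.
by apply: area_lt => //; lra.
Qed.

Lemma area_inj x y : -1 < x < 1 -> -1 < y < 1 -> area x = area y -> x = y.
Proof.
move=> /andP[x1 x2] /andP[y1 y2] E; apply/eqP; case: ltgtP => // H.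
  by have := area_lt x1 y2 H; rewrite E ltxx.
by have := area_lt y1 x2 H; rewrite E ltxx.
Qed.

(** [xi > tau (|z1|^2)] forces both coordinates of the image of [z1] in the square to
    stay at relative distance more than [8 / xi] from the boundary, see [tau_bounds]. *)
Definition tau z : R := 8 / (1 - area ((1 + z) / 2)) + 16 / (1 - z) + 10.

Lemma smk_tau k z : -1 < z < 1 -> smk k tau z.
Proof.
move=> /andP[z1 z2]; have H : -1 < (1 + z) / 2 < 1 by lra.
have Dh : DS z (fun y => (1 + y) / 2) _ :=
  DS_mul (DS_add (DS_cst z 1) (D1_id z)) (DS_cst z 2^-1).
have A0 : 1 - area ((1 + z) / 2) != 0 by rewrite subr_eq0 gt_eqF ?area_lt1.
have B0 : 1 - z != 0 by rewrite subr_eq0 gt_eqF.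
have D := DS_add (DS_add (DS_mul (DS_cst z 8)
    (DS_comp (DS_sub (DS_cst z 1) (DS_comp Dh (D1_area H))) (D1_inv A0)))
  (DS_mul (DS_cst z 16) (DS_comp (DS_sub (DS_cst z 1) (D1_id z)) (D1_inv B0))))
  (DS_cst z 10).
by case: D.
Qed.

(** The argument (1 + z)/2 stands for sqrt z, the distance to the centre: it bounds it from above
    and, unlike it, is smooth at z = 0. The numerators 8 and 16 produce the margin 8/xi for [area]
    and for (1 - z)/2. *)
Lemma tau_bounds z : 0 <= z < 1 ->
  [/\ 8 < tau z * (1 - area ((1 + z) / 2)), 16 < tau z * (1 - z) & 24 < tau z].
Proof.
move=> /andP[z0 z1]; have H : -1 < (1 + z) / 2 < 1 by lra.
have := area_lt1 H; have := area_gt0 H; rewrite /tau.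
set A := area _ => A0 A1.
have a0 : 1 - A != 0 by rewrite subr_eq0 gt_eqF.
have b0 : 1 - z != 0 by rewrite subr_eq0 gt_eqF.
set p := 8 / (1 - A); set q := 16 / (1 - z).
have pE : p * (1 - A) = 8 by rewrite /p divfK.
have qE : q * (1 - z) = 16 by rewrite /q divfK.
have p8 : 8 < p by rewrite /p ltr_pdivlMr ?subr_gt0//; nra.
have q16 : 16 <= q by rewrite /q ler_pdivlMr ?subr_gt0//; nra.
by split; [nra|nra|lra].
Qed.

(** [tent e] is a smoothing of [1 - |u|] whose slope never exceeds 1, up to an error
    [4 e] at the origin; [lift_angle e] dominates its slope and vanishes with it. *)
Definition tz e u : R := (1 - e - Num.sqrt (u ^+ 2 + e ^+ 2)) / e.
Definition tent e u : R := e * tz e u * flat 0 (tz e u).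
Definition dtent e u : R :=
  - (flat 0 (tz e u) + flat 1 (tz e u)) * (u / Num.sqrt (u ^+ 2 + e ^+ 2)).
Definition lift_angle e u : R := pi / 2 * (flat 0 (tz e u) + flat 1 (tz e u)).

Section tent.
Variable e : R.
Hypothesis e0 : 0 < e.
Let q u := Num.sqrt (u ^+ 2 + e ^+ 2).

Let q2_gt0 u : 0 < u ^+ 2 + e ^+ 2.
Proof. by rewrite ltr_wpDl ?sqr_ge0 ?exprn_gt0. Qed.

Let q_gt0 u : 0 < q u. Proof. by rewrite sqrtr_gt0. Qed.

Let norm_le_q u : `|u| <= q u.
Proof.
rewrite -ler_sqr ?nnegrE ?normr_ge0 ?(ltW (q_gt0 u))// sqr_sqrtr ?(ltW (q2_gt0 u))//.
by rewrite real_normK ?num_real// lerDl sqr_ge0.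
Qed.

Lemma D1_tz u : D1 u (tz e) (- (u / q u / e)).
Proof.
have D := DS_mul (DS_sub (DS_cst u (1 - e)) (DS_comp (DS_add (DS_pow 2 (D1_id u))
  (DS_cst u (e ^+ 2))) (D1_sqrt (q2_gt0 u)))) (DS_cst u e^-1).
apply: DS_eq D _ => v; rewrite -/(q u).
by field; rewrite !gt_eqF// q_gt0.
Qed.

Lemma D1_tent u : D1 u (tent e) (dtent e u).
Proof.
have D := DS_mul (DS_mul (DS_cst u e) (D1_tz u)) (DS_comp (D1_tz u) (D1_flat 0 (tz e u))).
apply: DS_eq D _ => v; rewrite /dtent -/(q u) (flatSr 1).
by field; rewrite !gt_eqF// q_gt0.
Qed.

Lemma smk_dtent k u : smk k (dtent e) u.
Proof.
rewrite (_ : dtent e = (fun y => 'D_(1 : R) (tent e) y)).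
  by apply: smk_derive => i; case: (D1_tent u).
by apply/funext => y; have [_ ->] := D1_is_derive (D1_tent y).
Qed.

Lemma smk_lift_angle k u : smk k (lift_angle e) u.
Proof.
have D := DS_mul (DS_cst u (pi / 2)) (DS_add (DS_comp (D1_tz u) (D1_flat 0 (tz e u)))
  (DS_comp (D1_tz u) (D1_flat 1 (tz e u)))).
by case: D.
Qed.

Lemma tent_ge0 u : 0 <= tent e u.
Proof.
rewrite /tent; have [z0|z0] := leP (tz e u) 0; first by rewrite flat_le0// mulr0.
by rewrite mulr_ge0 ?flat_ge0// mulr_ge0 ?ltW.
Qed.

Let tzE u : e * tz e u = 1 - e - q u.
Proof. by rewrite /tz -/(q u); field; rewrite gt_eqF. Qed.

Lemma flat0_le1 z : flat 0 z <= 1.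
Proof. by have := flat01_le1 z; have := flat_ge0 1 z; lra. Qed.

Lemma tent_le u : `|u| <= 1 -> tent e u <= 1 - `|u|.
Proof.
move=> u1; rewrite /tent; have [z0|z0] := leP (tz e u) 0.
  by rewrite flat_le0// mulr0 subr_ge0.
rewrite (@le_trans _ _ (e * tz e u))//.
  by rewrite ler_piMr ?flat0_le1// mulr_ge0 ?ltW.
by rewrite tzE; move: (norm_le_q u) e0; move: (q u) => Q; lra.
Qed.

Let tz_le0 u : 1 - e <= `|u| -> tz e u <= 0.
Proof.
move=> ue; rewrite -(@pmulr_rle0 _ e)// tzE.
by move: (norm_le_q u) ue; move: (q u) => Q; lra.
Qed.

(** Used near |u| = 1, at the two ends of a half loop, where the half with the tent is glued to the
    one without. *)
Lemma tent_outside u : 1 - e <= `|u| ->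
  [/\ tent e u = 0, dtent e u = 0 & lift_angle e u = 0].
Proof.
move=> /tz_le0 z0; rewrite /tent /dtent /lift_angle !flat_le0//.
by rewrite addr0 oppr0 !mulr0 mul0r.
Qed.

Lemma lift_angle_bound u : 0 <= lift_angle e u <= pi / 2.
Proof.
have p0 : 0 <= (pi / 2 : R) by rewrite divr_ge0 ?pi_ge0.
rewrite mulr_ge0 ?addr_ge0 ?flat_ge0//=.
by rewrite ler_piMr ?flat01_le1.
Qed.

(** Up to the constant pi/2, the slope differs from [lift_angle] only by a factor u / sqrt(u^2 +
    e^2) and a sign. *)
Lemma dtent_bound u : pi / 2 * `|dtent e u| <= lift_angle e u.
Proof.
have p0 : 0 <= (pi / 2 : R) by rewrite divr_ge0 ?pi_ge0.
rewrite ler_wpM2l// /dtent normrM normrN (ger0_norm (addr_ge0 (flat_ge0 _ _) (flat_ge0 _ _))).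
rewrite ler_piMr ?addr_ge0 ?flat_ge0// normrM normfV (gtr0_norm (q_gt0 u)).
by rewrite ler_pdivrMr ?q_gt0// mul1r norm_le_q.
Qed.

Lemma dtent_le1 u : `|dtent e u| <= 1.
Proof.
rewrite -(@ler_pM2l _ (pi / 2)) ?divr_gt0 ?pi_gt0// mulr1.
by rewrite (le_trans (dtent_bound u))//; have /andP[] := lift_angle_bound u.
Qed.

(** The four units of [e]: one from the offset in [tz], two from sqrt(u^2 + e^2) <= 2e, one from
    e^(-1/z) >= 1 - 1/z. *)
Lemma tent_center u : `|u| <= e -> 1 - 4 * e <= tent e u.
Proof.
move=> ue; have qu : q u <= 2 * e.
  rewrite -ler_sqr ?nnegrE ?(ltW (q_gt0 u)) ?mulr_ge0 ?(ltW e0)//.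
  rewrite sqr_sqrtr ?(ltW (q2_gt0 u))// -(real_normK (num_real u)).
  by move: (normr_ge0 u) ue e0; move: `|u| => t; nra.
rewrite /tent; have [z0|z0] := leP (tz e u) 0.
  rewrite flat_le0// mulr0; have : e * tz e u <= 0 by rewrite pmulr_rle0.
  by rewrite tzE; move: qu; move: (q u) => Q; lra.
rewrite (@le_trans _ _ (e * tz e u - e))//; first by rewrite tzE; move: qu; move: (q u) => Q; lra.
rewrite /flat z0 expr0 mul1r; have := expR_ge1Dx (- (tz e u)^-1) => H.
rewrite (@le_trans _ _ (e * tz e u * (1 - (tz e u)^-1)))//; last first.
  by rewrite ler_pM2l// mulr_gt0.
by rewrite mulrBr mulr1 -mulrA divff ?mulr1// gt_eqF.
Qed.

End tent.

End profiles.

(** * The elementary symplectic maps *)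

Section factors.
Context {R : realType} (n : nat).
Local Notation E := 'rV[R]_(n.*2).
Hypothesis n3 : (3 <= n)%N.
Implicit Types p : E.

Let C p k := DS_coord p k.

(** The cotangent lift of exp. In the same way [to_halfstrip] and [to_strip] lift [sg]: one
    coordinate is changed and its conjugate is divided by the derivative. *)
Definition to_halfplane p : E :=
  upd6 p (coord p 0) (coord p 1) (expR (coord p 2))
    (coord p 3 * expR (- coord p 2)) (coord p 4) (coord p 5).

Lemma symp_to_halfplane p : symp_at to_halfplane p.
Proof.
apply: (symp_at_upd6 n3 (C p 0) (C p 1) (DS_comp (C p 2) (D1_expR _))
  (DS_mul (C p 3) (DS_comp (DS_opp (C p 2)) (D1_expR _))) (C p 4) (C p 5)) => u v.
by rewrite expRN; field; rewrite gt_eqF ?expR_gt0.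
Qed.

Definition to_halfstrip p : E :=
  upd6 p (coord p 0) (coord p 1) (coord p 2 * (2 * jap (coord p 3) ^+ 3))
    (sg (coord p 3) - 1) (coord p 4) (coord p 5).

Lemma symp_to_halfstrip p : symp_at to_halfstrip p.
Proof.
have j0 : jap (coord p 3) != 0 by rewrite gt_eqF ?jap_gt0.
apply: (symp_at_upd6 n3 (C p 0) (C p 1)
  (DS_mul (C p 2) (DS_mul (DS_cst p 2) (DS_pow 3 (DS_comp (C p 3) (D1_jap _)))))
  (DS_sub (DS_comp (C p 3) (D1_sg _)) (DS_cst p 1)) (C p 4) (C p 5)) => u v /=.
by field.
Qed.

Definition to_strip p : E :=
  upd6 p (coord p 0) (coord p 1) (coord p 2) (coord p 3)
    (sg (coord p 4)) (coord p 5 * (2 * jap (coord p 4) ^+ 3)).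

Lemma symp_to_strip p : symp_at to_strip p.
Proof.
have j0 : jap (coord p 4) != 0 by rewrite gt_eqF ?jap_gt0.
apply: (symp_at_upd6 n3 (C p 0) (C p 1) (C p 2) (C p 3)
  (DS_comp (C p 4) (D1_sg _))
  (DS_mul (C p 5) (DS_mul (DS_cst p 2) (DS_pow 3 (DS_comp (C p 4) (D1_jap _))))))
  => u v /=.
by field.
Qed.

(** The flow of the Hamiltonian [tau (|z1|^2) t]: it pushes the points near the boundary
    of the disc towards [xi = +oo], which is what makes the radius [sqrt 3] itself
    attainable. *)
Definition dtau (z : R) : R := 'D_(1 : R) tau z.
Definition twist_angle p : R :=
  -2 * dtau (coord p 0 ^+ 2 + coord p 1 ^+ 2) * coord p 3.

Definition twist p : E :=
  upd6 p
    (coord p 0 * cos (twist_angle p) - coord p 1 * sin (twist_angle p))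
    (coord p 0 * sin (twist_angle p) + coord p 1 * cos (twist_angle p))
    (coord p 2 + tau (coord p 0 ^+ 2 + coord p 1 ^+ 2)) (coord p 3)
    (coord p 4) (coord p 5).

Lemma symp_twist p : coord p 0 ^+ 2 + coord p 1 ^+ 2 < 1 -> symp_at twist p.
Proof.
move=> a1; have a0 : -1 < coord p 0 ^+ 2 + coord p 1 ^+ 2.
  by rewrite (lt_le_trans _ (addr_ge0 (sqr_ge0 _) (sqr_ge0 _)))// ltrN10.
have aI : -1 < coord p 0 ^+ 2 + coord p 1 ^+ 2 < 1 by rewrite a0.
have Dt := D1_derive (fun k => smk_tau k aI).
have Ddt := D1_derive (smk_derive (1 : R) (fun k => smk_tau k aI)).
have Da := DS_add (DS_pow 2 (C p 0)) (DS_pow 2 (C p 1)).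
set x := coord p 0; set y := coord p 1; set t := coord p 3.
set t1 := 'D_1 tau (x ^+ 2 + y ^+ 2) in Dt.
set t2 := 'D_1 _ (x ^+ 2 + y ^+ 2) in Ddt.
pose al (w : E) := 2 * (x * coord w 0 + y * coord w 1).
pose dph w := -2 * (t2 * al w * t + t1 * coord w 3).
have Dph : DS p twist_angle dph.
  apply: DS_eq (DS_mul (DS_mul (DS_cst p (-2)) (DS_comp Da Ddt)) (C p 3)) _ => w.
  by rewrite /= -/x -/y -/t -/t1 /dph /al; ring.
apply: (symp_at_upd6 n3
  (DS_sub (DS_mul (C p 0) (DS_comp Dph (D1_cos _)))
          (DS_mul (C p 1) (DS_comp Dph (D1_sin _))))
  (DS_add (DS_mul (C p 0) (DS_comp Dph (D1_sin _)))
          (DS_mul (C p 1) (DS_comp Dph (D1_cos _))))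
  (DS_add (C p 2) (DS_comp Da Dt)) (C p 3) (C p 4) (C p 5)) => u v.
have := cos2Dsin2 (twist_angle p).
move: (cos (twist_angle p)) (sin (twist_angle p)) => c s cs /=.
rewrite -/x -/y.
(* A rotation by a variable angle phi adds half of d|z1|^2 wedge d phi. Its part in dt cancels what
   [tau] adds to [xi]; the part with the second derivative of [tau] is a multiple of d|z1|^2 and
   drops out. *)
transitivity ((c ^+ 2 + s ^+ 2) * (coord u 0 * coord v 1 - coord u 1 * coord v 0 +
    2^-1 * (al u * dph v - al v * dph u)) +
    ((coord u 2 + t1 * al u) * coord v 3 - coord u 3 * (coord v 2 + t1 * al v)) +
    (coord u 4 * coord v 5 - coord u 5 * coord v 4)).
  by rewrite /al; field.
by rewrite cs /dph /al; field.
Qed.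

Definition to_square p : E :=
  upd6 p (area (coord p 0)) (coord p 1 * (pi / 2 / chord (coord p 0)))
    (coord p 2) (coord p 3) (coord p 4) (coord p 5).

Lemma symp_to_square p : -1 < coord p 0 < 1 -> symp_at to_square p.
Proof.
move=> I; have c0 : chord (coord p 0) != 0 by rewrite gt_eqF ?chord_gt0.
have p0 : (pi : R) != 0 by rewrite gt_eqF ?pi_gt0.
apply: (symp_at_upd6 n3 (DS_comp (C p 0) (D1_area I))
  (DS_mul (C p 1) (DS_mul (DS_cst p (pi / 2))
     (DS_comp (DS_comp (C p 0) (D1_chord I)) (D1_inv c0))))
  (C p 2) (C p 3) (C p 4) (C p 5)) => u v /=.
by move: (@pi R) p0 => P p0; field; rewrite ?c0 ?p0.
Qed.

(** The strip is wound around the origin, one lap per unit of [xi ^+ 4]; [rad2] is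
    dictated by area preservation and by loops of area about [xi ^- 2]. *)
Definition rad2 (xi t : R) : R := xi^-1 ^+ 2 + t / (4 * pi) * xi^-1 ^+ 3.
Definition phase (xi : R) : R := 2 * pi * xi ^+ 4.

Definition coil p : E :=
  upd6 p (coord p 0) (coord p 1)
    (Num.sqrt (rad2 (coord p 2) (coord p 3)) * cos (phase (coord p 2)))
    (- (Num.sqrt (rad2 (coord p 2) (coord p 3)) * sin (phase (coord p 2))))
    (coord p 4) (coord p 5).

Lemma symp_coil p : coord p 2 != 0 -> 0 < rad2 (coord p 2) (coord p 3) ->
  symp_at coil p.
Proof.
move=> x0 r0; have p0 : (pi : R) != 0 by rewrite gt_eqF ?pi_gt0.
have Di := DS_comp (C p 2) (D1_inv x0).
set x := coord p 2 in x0 Di *; set t := coord p 3.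
set r := Num.sqrt (rad2 x t).
have r1 : 0 < r by rewrite sqrtr_gt0.
have rN0 := lt0r_neq0 r1.
pose dr (w : E) := (2 * (- x ^- 2) * x^-1 * coord w 2 +
  (coord w 3 / (4 * pi) * x^-1 ^+ 3 +
   t / (4 * pi) * (3 * x^-1 ^+ 2 * (- x ^- 2) * coord w 2))) / (2 * r).
pose dph (w : E) := 2 * pi * (4 * x ^+ 3 * coord w 2).
have Dr : DS p (fun p => Num.sqrt (rad2 (coord p 2) (coord p 3))) dr.
  have D := DS_comp (DS_add (DS_pow 2 Di)
    (DS_mul (DS_mul (C p 3) (DS_cst p (4 * pi)^-1)) (DS_pow 3 Di))) (D1_sqrt r0).
  apply: DS_eq D _ => w; rewrite /= -/x -/t -/r /dr; clearbody r.
  by move: (@pi R) p0 => P p0; field; rewrite ?rN0 ?p0 ?x0.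
have Dph : DS p (fun p => phase (coord p 2)) dph.
  have D := DS_mul (DS_cst p (2 * pi)) (DS_pow 4 (C p 2)).
  by apply: DS_eq D _ => w; rewrite /= -/x /dph; ring.
apply: (symp_at_upd6 n3 (C p 0) (C p 1) (DS_mul Dr (DS_comp Dph (D1_cos _)))
  (DS_opp (DS_mul Dr (DS_comp Dph (D1_sin _)))) (C p 4) (C p 5)) => u v.
rewrite -/x -/t -/r; have := cos2Dsin2 (phase x).
move: (cos (phase x)) (sin (phase x)) => c s cs.
(* The minus sign in the second coordinate turns the polar form into d phi wedge r dr; here phi' = 8
   pi xi^3, and r dr has dt-part xi^(-3) / (8 pi), with product 1. *)
transitivity (coord u 0 * coord v 1 - coord u 1 * coord v 0 +
  (c ^+ 2 + s ^+ 2) * r * (dph u * dr v - dr u * dph v) +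
  (coord u 4 * coord v 5 - coord u 5 * coord v 4)); first by ring.
by rewrite cs /dr /dph; clearbody r; move: (@pi R) p0 => P p0; field; rewrite ?rN0 ?p0 ?x0.
Qed.

Definition shift_sheet (g g' : R -> R) p : E :=
  upd6 p (coord p 0) (coord p 1) (coord p 2) (coord p 3 - g' (coord p 2) * coord p 5)
    (coord p 4 + g (coord p 2)) (coord p 5).

Lemma symp_shift_sheet g g' p : D1 (coord p 2) g (g' (coord p 2)) ->
  (forall k, smk k g' (coord p 2)) -> symp_at (shift_sheet g g') p.
Proof.
move=> Dg sg'; apply: (symp_at_upd6 n3 (C p 0) (C p 1) (C p 2)
  (DS_sub (C p 3) (DS_mul (DS_comp (C p 2) (D1_derive sg')) (C p 5)))
  (DS_add (C p 4) (DS_comp (C p 2) Dg)) (C p 5)) => u v /=.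
by ring.
Qed.

(** Stretches the loops, of radius about [sigma ^ (-1/4)], to ellipses with long half-axis
    close to 1. The correction of the last coordinate makes up for the dependence of the
    factor on [sigma]. *)
Definition squeeze p : E :=
  upd6 p (coord p 0) (coord p 1)
    (coord p 2 * Num.sqrt (Num.sqrt (coord p 4)))
    (coord p 3 / Num.sqrt (Num.sqrt (coord p 4)))
    (coord p 4) (coord p 5 - coord p 2 * coord p 3 / (4 * coord p 4)).

Lemma symp_squeeze p : 0 < coord p 4 -> symp_at squeeze p.
Proof.
move=> s0; have s1 : 0 < Num.sqrt (coord p 4) by rewrite sqrtr_gt0.
have s2 : 0 < Num.sqrt (Num.sqrt (coord p 4)) by rewrite sqrtr_gt0.
have l0 := lt0r_neq0 s2.
have s40 : 4 * coord p 4 != 0 by rewrite mulf_neq0// gt_eqF.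
have Dl := DS_comp (DS_comp (C p 4) (D1_sqrt s0)) (D1_sqrt s1).
apply: (symp_at_upd6 n3 (C p 0) (C p 1) (DS_mul (C p 2) Dl)
  (DS_mul (C p 3) (DS_comp Dl (D1_inv l0))) (C p 4)
  (DS_sub (C p 5) (DS_mul (DS_mul (C p 2) (C p 3))
     (DS_comp (DS_mul (DS_cst p 4) (C p 4)) (D1_inv s40))))) => u v /=.
have E : coord p 4 = Num.sqrt (Num.sqrt (coord p 4)) ^+ 4.
  by rewrite (exprM _ 2 2) !sqr_sqrtr ?ltW.
have E1 : Num.sqrt (coord p 4) = Num.sqrt (Num.sqrt (coord p 4)) ^+ 2.
  by rewrite sqr_sqrtr ?ltW.
move: l0 E E1; set l := Num.sqrt (Num.sqrt _) => l0 E E1.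
rewrite E1 E {E E1}; move: l l0 => l l0; by field; rewrite ?l0.
Qed.

Definition displace (K K' o : R -> R) p : E :=
  upd6 p (coord p 0 + K (coord p 2)) (coord p 1) (1 + coord p 2)
    (coord p 3 - o (coord p 2) - K' (coord p 2) * coord p 1)
    (coord p 4) (coord p 5).

Lemma symp_displace K K' o p : D1 (coord p 2) K (K' (coord p 2)) ->
  (forall k, smk k K' (coord p 2)) -> (forall k, smk k o (coord p 2)) ->
  symp_at (displace K K' o) p.
Proof.
move=> DK sK' so; apply: (symp_at_upd6 n3 (DS_add (C p 0) (DS_comp (C p 2) DK))
  (C p 1) (DS_add (DS_cst p 1) (C p 2))
  (DS_sub (DS_sub (C p 3) (DS_comp (C p 2) (D1_derive so)))
     (DS_mul (DS_comp (C p 2) (D1_derive sK')) (C p 1))) (C p 4) (C p 5)) => u v /=.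
by ring.
Qed.

(** The squared radius is the action itself and the angle is doubled, so dA wedge d theta becomes
    the standard form and a full turn has length pi. *)
Definition to_cartesian p : E :=
  upd6 p (Num.sqrt (coord p 0) * cos (2 * coord p 1))
    (Num.sqrt (coord p 0) * sin (2 * coord p 1))
    (Num.sqrt (coord p 2) * cos (2 * coord p 3))
    (Num.sqrt (coord p 2) * sin (2 * coord p 3)) (coord p 4) (coord p 5).

Lemma symp_to_cartesian p : 0 < coord p 0 -> 0 < coord p 2 -> symp_at to_cartesian p.
Proof.
move=> a0 b0.
have Da := DS_comp (C p 0) (D1_sqrt a0); have Db := DS_comp (C p 2) (D1_sqrt b0).
have Dt := DS_mul (DS_cst p 2) (C p 1); have Ds := DS_mul (DS_cst p 2) (C p 3).
apply: (symp_at_upd6 n3 (DS_mul Da (DS_comp Dt (D1_cos _)))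
  (DS_mul Da (DS_comp Dt (D1_sin _))) (DS_mul Db (DS_comp Ds (D1_cos _)))
  (DS_mul Db (DS_comp Ds (D1_sin _))) (C p 4) (C p 5)) => u v /=.
have a1 : 0 < Num.sqrt (coord p 0) by rewrite sqrtr_gt0.
move: (lt0r_neq0 a1); move: (Num.sqrt (coord p 0)) => a aN0.
have b1 : 0 < Num.sqrt (coord p 2) by rewrite sqrtr_gt0.
move: (lt0r_neq0 b1); move: (Num.sqrt (coord p 2)) => b bN0.
have := cos2Dsin2 (2 * coord p 1); move: (cos (2 * coord p 1)) (sin (2 * coord p 1)).
move=> c s cs.
have := cos2Dsin2 (2 * coord p 3); move: (cos (2 * coord p 3)) (sin (2 * coord p 3)).
move=> c' s' cs'.
transitivity ((c ^+ 2 + s ^+ 2) * (coord u 0 * coord v 1 - coord u 1 * coord v 0) +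
  (c' ^+ 2 + s' ^+ 2) * (coord u 2 * coord v 3 - coord u 3 * coord v 2) +
  (coord u 4 * coord v 5 - coord u 5 * coord v 4)).
  by field; rewrite ?aN0 ?bN0.
by rewrite cs cs' !mul1r.
Qed.

End factors.

(** * Continuity of the inverse *)

(** Completeness of the space of row vectors, for the fixed point theorem in [local_surjection]. *)
HB.instance Definition _ (R : realType) (m n : nat) :=
  Uniform_isComplete.Build 'M[R]_(m, n) cauchy_cvg.

Section inverse.
Context {R : realType}.

Lemma row_norm_le m (x : 'rV[R]_m) (c : R) : 0 <= c ->
  (forall i, `|x ord0 i| <= c) -> `|x| <= c.
Proof.
move=> c0 H; rewrite [leLHS]/Num.Def.normr/= mx_normrE (bigmax_le _ c0)//= => -[i j] _.
by rewrite /= (ord1 i).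
Qed.

Lemma row_coord_le m (x : 'rV[R]_m) i : `|x ord0 i| <= `|x|.
Proof.
rewrite [leRHS]/Num.Def.normr/= mx_normrE.
exact: (@le_bigmax _ _ _ _ (fun i => `|x i.1 i.2|) (ord0, i)).
Qed.

Lemma is_derive_line (V : normedModType R) (g : V -> R) y v t :
  differentiable g (y + t *: v) ->
  is_derive t (1 : R) (fun s : R => g (y + s *: v)) ('D_v g (y + t *: v)).
Proof.
move=> dg.
pose l : R -> V := cst y + ( *:%R^~ v).
have dl : is_diff t l (0 + ( *:%R^~ v)) by apply: is_diffD.
have dgl : differentiable (g \o l) t by apply: differentiable_comp => //; exact: ex_diff.
apply: DeriveDef; first exact/derivable1_diffP.
transitivity ('d (g \o l) t (1 : R)); first exact: deriveE.
rewrite diff_comp//=.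
by rewrite diff_val deriveE//= fctE/= add0r scale1r.
Qed.

(** All partial derivatives of [G] vanish at [p], hence are small nearby; the mean value theorem
    along a segment of the ball bounds each coordinate of the difference in the sup norm. *)
Lemma contraction_near m (G : 'rV[R]_m -> 'rV[R]_m) (p : 'rV[R]_m) :
  smv G p -> (forall v, 'd G p v = 0) ->
  \forall r \near 0^'+, forall x y, `|x - p| < r -> `|y - p| < r ->
    `|G x - G y| <= 2^-1 * `|x - y|.
Proof.
(* A sum of [m] partial derivatives of size [c] is at most 1/2; the successor keeps the denominator
   non-zero for m = 0. *)
move=> sG dG; pose c : R := (2 * m.+1%:R)^-1.
have c0 : 0 < c by rewrite invr_gt0 mulr_gt0.
have N0 i j : \forall x \near p, `|'D_(delta_mx ord0 j) (fun z => G z ord0 i) x| <= c.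
  have [_ /(_ (delta_mx ord0 j)) [dD _]] := sG i 2.
  have cD := differentiable_continuous (nbhs_singleton dD).
  have D0 : 'D_(delta_mx ord0 j) (fun z => G z ord0 i) p = 0.
    by rewrite -derive_coord ?deriveE ?dG ?mxE//; exact: smv_diff.
  by move: cD; rewrite /prop_for /continuous_at D0 => /cvgr0Pnorm_le; exact.
have N1 : \forall x \near p, forall i j,
    `|'D_(delta_mx ord0 j) (fun z => G z ord0 i) x| <= c.
  apply: (@filter_forall _ _ (fun i x => forall j, `|'D_(delta_mx ord0 j)
    (fun z => G z ord0 i) x| <= c) (nbhs p) _) => i.
  exact: (@filter_forall _ _ (fun j x => `|'D_(delta_mx ord0 j)
    (fun z => G z ord0 i) x| <= c) (nbhs p) _ (N0 i)).
have N2 : \forall x \near p, differentiable G x by exact: smv_near_diff.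
have [e /= e0 He] : nbhs_ball p (fun x => (forall i j,
    `|'D_(delta_mx ord0 j) (fun z => G z ord0 i) x| <= c) /\ differentiable G x).
  apply/nbhs_ballP; near=> x; split; [exact: (near N1 x)|exact: (near N2 x)].
near=> r => x y xr yr.
have re : r < e by near: r; exact: nbhs_right_lt.
apply: row_norm_le => [|i]; first by rewrite mulr_ge0.
pose g (t : R) : R := G (y + t *: (x - y)) ord0 i.
have seg (t : R) : 0 <= t <= 1 -> ball p e (y + t *: (x - y)).
  move=> /andP[t0 t1]; rewrite -ball_normE /ball_ /= distrC.
  have -> : y + t *: (x - y) - p = (1 - t) *: (y - p) + t *: (x - p).
    rewrite scalerBl scale1r !scalerBr !opprB; apply/rowP => j; rewrite !mxE; ring.
  apply: le_lt_trans (ler_normD _ _) _; rewrite !normrZ ger0_norm ?subr_ge0//.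
  rewrite ger0_norm//; apply: le_lt_trans re.
  rewrite (_ : r = (1 - t) * r + t * r); last by ring.
  by rewrite lerD// ler_wpM2l ?subr_ge0// ltW.
pose h (t : R) : R := \sum_j (x - y) ord0 j *
  'D_(delta_mx ord0 j) (fun z => G z ord0 i) (y + t *: (x - y)).
have gh (t : R) : 0 <= t <= 1 -> is_derive t (1 : R) g (h t).
  move=> /seg/He[_ dGt]; have dGi : differentiable (fun z => G z ord0 i) (y + t *: (x - y)).
    exact: (differentiable_comp dGt (differentiable_coord _ _ _)).
  have -> : h t = 'D_(x - y) (fun z => G z ord0 i) (y + t *: (x - y)).
    rewrite deriveE// [X in _ = 'd _ _ X]row_sum_delta linear_sum/=.
    by apply: eq_bigr => j _; rewrite linearZ/= deriveE.
  exact: is_derive_line.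
have gc : {within `[(0 : R), 1], continuous g}.
  by apply: derivable_within_continuous => t; rewrite in_itv/= => /gh; case.
have gh' (t : R) : t \in `](0 : R), 1[ -> is_derive t (1 : R) g (h t).
  by rewrite in_itv => /andP[t0 t1]; apply: gh; rewrite !ltW.
have [t] := MVT ltr01 gh' gc; rewrite in_itv /= => /andP[t0 t1].
have -> : g 1 = G x ord0 i by rewrite /g scale1r addrC subrK.
have -> : g 0 = G y ord0 i by rewrite /g scale0r addr0.
rewrite subr0 mulr1 !mxE => ->.
have [Hc _] := He _ (seg t ltac:(by rewrite !ltW)).
apply: le_trans (ler_norm_sum _ _ _) _.
apply: (@le_trans _ _ (\sum_(j < m) `|x - y| * c)).
  by apply: ler_sum => j _; rewrite normrM ler_pM// row_coord_le.
rewrite sumr_const card_ord -[leLHS]mulr_natr -mulrA [leRHS]mulrC; apply: ler_wpM2l => //.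
rewrite /c invfM -mulrA ler_piMr ?invr_ge0// mulrC ler_pdivrMr// mul1r ler_nat.
exact: leqnSn.
Unshelve. all: by end_near. Qed.


Lemma diff_linear_comp (V W W' : normedModType R) (A : {linear W -> W'}) (f : V -> W) p :
  continuous A -> differentiable f p -> 'd (A \o f) p = A \o 'd f p :> (V -> W').
Proof.
move=> cA df; have dA := linear_differentiable (f p) cA.
by rewrite (diff_comp df dA); congr (_ \o _); exact: diff_lin.
Qed.

Lemma diff_linear_compE (V W W' : normedModType R) (A : {linear W -> W'}) (f : V -> W)
    p v : continuous A -> differentiable f p -> 'd (A \o f) p v = A ('d f p v).
Proof. by move=> cA df; rewrite (diff_linear_comp cA df). Qed.

Lemma diff_id_sub (V : normedModType R) (h : V -> V) (p v : V) :
  differentiable h p -> 'd (id - h) p v = v - 'd h p v.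
Proof.
move=> dh; have did : is_diff p (@id V) id by exact: is_diff_id.
have dB := @diffB _ _ _ id h p (@ex_diff _ _ _ _ _ _ _ did) dh.
transitivity ('d (@id V) p v - 'd h p v); first exact: (congr1 (fun F : V -> V => F v) dB).
by rewrite diff_val.
Qed.

Lemma smk_entry m (i : 'I_m) k (y : 'rV[R]_m) : smk k (fun z : 'rV[R]_m => z ord0 i) y.
Proof.
rewrite (_ : (fun z => _) = (fun z : 'rV[R]_m => coord z i)).
  by case: (DS_coord y i).
by apply/funext => z; rewrite (coordE _ (ltn_ord i)); congr (z _ _); exact: val_inj.
Qed.

(** Simplified Newton iteration: with [A] the inverse of the differential at [p], the solutions of f
    x = q are the fixed points of x - A (f x) + A q, and x - A (f x) has zero differential at
    [p]. *)
Lemma local_surjection m (f : 'rV[R]_m -> 'rV[R]_m) (p : 'rV[R]_m) (J : 'M[R]_m) :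
  smv f p -> (forall v, 'd f p v = v *m J) -> J \in unitmx ->
  forall e, 0 < e -> \forall q \near f p, exists2 x, `|x - p| <= e & f x = q.
Proof.
move=> sf dJ uJ e e0.
have [A AE] : exists A : {linear 'rV[R]_m -> 'rV[R]_m}, forall y, A y = y *m invmx J.
  by exists (mulmxr (invmx J)).
have sA (y : 'rV[R]_m) : smv A y.
  move=> i k; rewrite (_ : (fun z => _) = (fun z : 'rV[R]_m => \sum_j z ord0 j * invmx J j i)).
    apply: smk_sum => j; apply: smkM; last exact: smk_cst.
    exact: smk_entry.
  by apply/funext => z; rewrite AE mxE.
have cA : continuous A by move=> y; exact/differentiable_continuous/smv_diff.
pose G : 'rV[R]_m -> 'rV[R]_m := id - (A \o f).
have GE x : G x = x - A (f x) by [].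
have sG : smv G p.
  move=> i k; rewrite (_ : (fun z => _) = (fun z : 'rV[R]_m => z ord0 i + -1 * (A (f z)) ord0 i)).
    apply: smkD; last by apply: smkM; [exact: smk_cst|exact: (smv_comp sf (sA (f p)))].
    exact: smk_entry.
  by apply/funext => z; rewrite GE mulN1r !mxE.
have dG v : 'd G p v = 0.
  have dAf : differentiable (A \o f) p by exact: smv_diff (smv_comp sf (sA (f p))).
  have dAfE : 'd (A \o f) p v = A ('d f p v).
    exact: (diff_linear_compE v cA (smv_diff sf)).
  by rewrite (diff_id_sub v dAf) dAfE dJ AE (mulmxK uJ) subrr.
have [k k0 Ak] := linear_lipschitz cA.
near (0 : R)^'+ => r.
have r0 : 0 < r by near: r; exact: nbhs_right_gt.
have GL x y : `|x - p| < r -> `|y - p| < r -> `|G x - G y| <= 2^-1 * `|x - y|.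
  by move: x y; near: r; exact: contraction_near.
pose d := Num.min e (r / 2).
have d0 : 0 < d by rewrite lt_min e0 divr_gt0.
have de : d <= e by rewrite ge_min lexx.
have dr : d < r by rewrite gt_min [X in _ || X]ltr_pdivrMr// ltr_pMr// ltr1n orbT.
near=> q.
pose N x := G x + A q.
pose B : set 'rV[R]_m := [set x | `|x - p| <= d].
have NB : set_fun B B N.
  move=> x /= xd; rewrite /B/= /N.
  have -> : G x + A q - p = (G x - G p) + A (q - f p).
    rewrite (GE p) opprB [A (q - f p)]linearB -addrA -[RHS]addrA; congr (_ + _).
    by rewrite [RHS]addrC subrKA.
  apply: le_trans (ler_normD _ _) _.
  (* One half of the radius is used up by the contraction, the other by the distance from [q] to
     [f p]. *)
  rewrite (splitr d) lerD//.
    rewrite (le_trans (GL _ _ _ _)) ?subrr ?normr0//.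
      exact: le_lt_trans dr.
    by rewrite mulrC ler_pdivrMr// divfK.
  rewrite (le_trans (Ak _))// mulrC -ler_pdivlMr// distrC.
  near: q; apply: cvgr_dist_le; first exact: cvg_id.
  by rewrite !divr_gt0.
have cB : closed B.
  rewrite (_ : B = (fun x => `|x - p|) @^-1` [set x : R | x <= d])//.
  apply: closed_comp; last exact: closed_le.
  by move=> x _; apply: (@cvg_norm _ _ _ (nbhs x)); apply: cvgB; [exact: cvg_id|exact: cvg_cst].
have ctr : is_contraction (mkfun_fun NB).
  exists (2^-1)%:nng; split => /=; first by rewrite invf_lt1// ltr1n.
  move=> [x y] /= [xB yB]; rewrite /mkfun/= /N.
  rewrite (_ : G x + A q - (G y + A q) = G x - G y); last by rewrite opprD addrACA subrr addr0.
  by apply: GL; exact: le_lt_trans dr.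
have [|x xB xN] := banach_fixed_point ctr cB.
  by exists p; rewrite /B/= subrr normr0 ltW.
exists x; first exact: le_trans xB de.
have : A (f x) = A q.
  have {}xN : x = x - A (f x) + A q by rewrite -GE.
  have : - A (f x) + A q = 0 by apply: (@addrI _ x); rewrite addr0 addrA -xN.
  by move/eqP; rewrite addrC subr_eq0 => /eqP.
by move/(congr1 (mulmx^~ J)); rewrite !AE !mulmxKV.
Unshelve. all: by end_near. Qed.

Lemma omega_nondegenerate n (u : 'rV[R]_(n.*2)) :
  (forall v, omega u v = 0) -> u = 0.
Proof.
move=> H; apply: coord_inj => k kn; rewrite [RHS](coordE _ kn) mxE.
have dE j (jn : (j < n.*2)%N) : coord (delta_mx ord0 (Ordinal jn) : 'rV[R]_(n.*2)) =1
    (fun i => (i == j)%:R).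
  move=> i; have [jn'|ni] := ltnP i n.*2; first by rewrite (coordE _ jn') mxE eqxx.
  by rewrite coord_ge// gtn_eqF// (leq_trans jn ni).
have He h : (h < n)%N -> coord u h.*2 = 0 /\ coord u h.*2.+1 = 0.
  move=> hn; have h1 : (h.*2.+1 < n.*2)%N by rewrite ltn_Sdouble.
  have h0 : (h.*2 < n.*2)%N by exact: ltnW.
  split; [have := H (delta_mx ord0 (Ordinal h1))|have := H (delta_mx ord0 (Ordinal h0))].
  - rewrite /omega (bigD1 (Ordinal hn))//= big1 => [|i iN].
      rewrite !dE eqxx (_ : (h.*2 == _) = false); last by apply/eqP; lia.
      by rewrite mulr0 mulr1 subr0 addr0.
    rewrite !dE (_ : (i.*2 == _) = false); last by apply/eqP; lia.
    rewrite (_ : (i.*2.+1 == _) = false) ?mulr0 ?subrr//.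
    by apply: contra_neqF iN => /eqP iN; apply: val_inj => /=; lia.
  - rewrite /omega (bigD1 (Ordinal hn))//= big1 => [|i iN].
      rewrite !dE eqxx (_ : (h.*2.+1 == _) = false); last by apply/eqP; lia.
      by rewrite mulr0 mulr1 sub0r addr0 => /eqP; rewrite oppr_eq0 => /eqP.
    rewrite !dE (_ : (i.*2.+1 == _) = false); last by apply/eqP; lia.
    rewrite (_ : (i.*2 == _) = false) ?mulr0 ?subrr//.
    by apply: contra_neqF iN => /eqP iN; apply: val_inj => /=; lia.
have kn2 : (k./2 < n)%N by lia.
have [E0 E1] := He _ kn2.
by rewrite -(odd_double_half k); case: (odd k).
Qed.

(** Since [omega] is nondegenerate, a symplectic differential is invertible, so every value close to
    [f p] has a preimage close to [p]. By injectivity [g] has no other choice than this preimage. *)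
Lemma symp_inverse_continuous n (U : set 'rV[R]_(n.*2)) f :
  open U -> (forall x, U x -> symp_at f x) ->
  (forall x y, U x -> U y -> f x = f y -> x = y) ->
  exists g : 'rV[R]_(n.*2) -> 'rV[R]_(n.*2),
    (forall x, U x -> g (f x) = x) /\ {within f @` U, continuous g}.
Proof.
move=> oU sf injf.
have /choice[g gP] : forall q, exists x, forall y, U y -> f y = q -> x = y.
  move=> q; have [[y [Uy fy]]|noy] := pselect (exists y, U y /\ f y = q).
    by exists y => z Uz fz; apply: injf => //; rewrite fy.
  by exists 0 => y Uy fy; case: noy; exists y.
have gf x : U x -> g (f x) = x by move=> Ux; exact: gP.
exists g; split => //; apply/subspace_continuousP => _ [p Up <-].
rewrite /from_subspace gf//; apply/cvgrPdist_le => e e0.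
have [sfp op] := sf p Up.
have dJ v : 'd f p v = v *m 'J f p by rewrite /jacobian mul_rV_lin1.
have uJ : 'J f p \in unitmx.
  rewrite -row_free_unit -kermx_eq0; apply/eqP/row_matrixP => i; rewrite row0.
  apply: omega_nondegenerate => v; rewrite -op dJ.
  have c0 k : coord (0 : 'rV[R]_(n.*2)) k = 0.
    by rewrite /coord; case: insub => // j; rewrite mxE.
  by rewrite -row_mul mulmx_ker row0 /omega big1// => j _; rewrite !c0 !mul0r subrr.
have /nbhs_ballP[r /= r0 rU] : nbhs p U by exact: open_nbhs_nbhs.
pose d := Num.min e (r / 2).
have d0 : 0 < d by rewrite lt_min e0 divr_gt0.
have de : d <= e by rewrite ge_min lexx.
have dr : d < r by rewrite gt_min [X in _ || X]ltr_pdivrMr// ltr_pMr// ltr1n orbT.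
have := local_surjection sfp dJ uJ d0; apply: filterS => q [x xd <-] _.
rewrite gf; first by rewrite distrC; exact: le_trans de.
by apply: rU; rewrite -ball_normE /ball_ /= distrC (le_lt_trans xd).
Qed.

End inverse.

(** * Estimates *)

Section estimates.
Context {R : realType}.
Implicit Types (x y z u t e : R) (i j : int).

Definition root4 z : R := Num.sqrt (Num.sqrt z).

Lemma root4_ge0 z : 0 <= root4 z. Proof. exact: sqrtr_ge0. Qed.

Lemma root4_gt0 z : 0 < z -> 0 < root4 z.
Proof. by move=> z0; rewrite !sqrtr_gt0. Qed.

Lemma sqr_root4 z : root4 z ^+ 2 = Num.sqrt z.
Proof. by rewrite sqr_sqrtr ?sqrtr_ge0. Qed.

Lemma root4_lt y z : y < z -> 0 < z -> root4 y < root4 z.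
Proof. by move=> yz z0; rewrite ltr_sqrt ?sqrtr_gt0// ltr_sqrt. Qed.

Lemma root4_le y z : y <= z -> root4 y <= root4 z.
Proof. by move=> yz; rewrite !ler_wsqrtr. Qed.

Lemma root4_exp z : 0 <= z -> root4 (z ^+ 4) = z.
Proof.
by move=> z0; rewrite /root4 (exprM _ 2 2) sqrtr_sqr ger0_norm ?sqr_ge0// sqrtr_sqr ger0_norm.
Qed.

Lemma rad2_bounds xi t : 24 < xi -> -1 < t < 0 ->
  [/\ 0 < rad2 xi t, rad2 xi t < xi^-1 ^+ 2 & xi^-1 ^+ 2 * (1 - xi^-1 / 8) < rad2 xi t].
Proof.
move=> x24 /andP[t1 t0]; have x0 : 0 < xi by rewrite (lt_trans _ x24).
set y := xi^-1; have y0 : 0 < y by rewrite invr_gt0.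
have yx : y * xi = 1 by rewrite mulVf ?gt_eqF.
have y1 : y < 1 by nra.
have p8 : 8 <= 4 * pi :> R by have := pi_ge2 R; lra.
have p0 : 0 < 4 * pi :> R by lra.
have T0 : t / (4 * pi) < 0 by rewrite pmulr_llt0 ?invr_gt0.
have T1 : - (1 / 8) < t / (4 * pi).
  by rewrite ltr_pdivlMr//; nra.
rewrite /rad2 -/y; move: (t / (4 * pi)) T0 T1 => T T0 T1.
have -> : y ^+ 2 + T * y ^+ 3 = y ^+ 2 * (1 + T * y) by ring.
have y20 : 0 < y ^+ 2 by rewrite exprn_gt0.
split.
- by rewrite mulr_gt0//; nra.
- by rewrite gtr_pMr//; nra.
- by rewrite ltr_pM2l//; nra.
Qed.

Section squeezed_radius.
Variables xi t s : R.
Hypotheses (x24 : 24 < xi) (tI : -1 < t < 0) (sI : xi ^+ 4 - 3 < s < xi ^+ 4).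
Let r := Num.sqrt (rad2 xi t).

Let x0 : 0 < xi. Proof. by rewrite (lt_trans _ x24). Qed.

Lemma sigma_gt0 : 0 < s.
Proof.
have h24 := x24; have hx0 := x0.
case/andP: sI => s1 _; apply: le_lt_trans s1; rewrite subr_ge0.
have x2 : 3 < xi ^+ 2 by nra.
by rewrite (_ : xi ^+ 4 = xi ^+ 2 * xi ^+ 2); [nra|ring].
Qed.

Lemma sqrt_sigma_bounds : xi ^+ 2 - xi / 2 < Num.sqrt s /\ Num.sqrt s < xi ^+ 2.
Proof.
have h24 := x24; have hx0 := x0.
case/andP: sI => s1 s2; have s0 := sigma_gt0.
have x2 : 0 <= xi ^+ 2 - xi / 2 by nra.
have x20 : 0 <= xi ^+ 2 by rewrite sqr_ge0.
rewrite -(@ltr_sqr _ _ (Num.sqrt s)) ?nnegrE ?sqrtr_ge0//.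
rewrite -(@ltr_sqr _ (Num.sqrt s)) ?nnegrE ?sqrtr_ge0// sqr_sqrtr ?ltW//.
split; last by rewrite -exprM.
apply: lt_trans s1; have x3 : 24 < xi ^+ 3.
  have x2' : 24 < xi ^+ 2 by nra.
  by rewrite exprSr; nra.
have -> : (xi ^+ 2 - xi / 2) ^+ 2 = xi ^+ 4 - xi ^+ 3 + xi ^+ 2 / 4 by field.
have : xi ^+ 2 * 24 <= xi ^+ 3 by rewrite [leRHS]exprSr ler_pM2l ?exprn_gt0// ltW.
by move: (xi ^+ 4) (xi ^+ 3) x3 (xi ^+ 2) x20 => ? ? ? ? ?; lra.
Qed.

Lemma sqrt_sigma_ge : xi < Num.sqrt s.
Proof. have h24 := x24; by have [H _] := sqrt_sigma_bounds; apply: lt_trans H; nra. Qed.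

Lemma root4_sigma_gt1 : 1 < root4 s.
Proof.
have h24 := x24; have : 1 < root4 s ^+ 2 by rewrite sqr_root4 (lt_trans _ sqrt_sigma_ge)//; lra.
have := root4_ge0 s; nra.
Qed.

(** Above, sqrt s < xi^2 and rad2 < xi^(-2). Below, the relative losses 1/(2 xi) and 1/(8 xi) of
    these two factors add up to less than 1/xi; this bounds the square, and a positive number below
    1 exceeds its square. *)
Lemma squeezed_radius_bounds : 1 - xi^-1 < root4 s * r < 1.
Proof.
have h24 := x24; have hx0 := x0.
have [r0 r1 r2] := rad2_bounds x24 tI; have [l1 l2] := sqrt_sigma_bounds.
have rE : r ^+ 2 = rad2 xi t by rewrite sqr_sqrtr// ltW.
have r0' : 0 <= r by exact: sqrtr_ge0.
have y0 : 0 < xi^-1 by rewrite invr_gt0.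
have yx : xi^-1 * xi = 1 by rewrite mulVf ?gt_eqF.
have L0 : 0 < Num.sqrt s by exact: lt_trans sqrt_sigma_ge.
have m2 : (root4 s * r) ^+ 2 = Num.sqrt s * rad2 xi t by rewrite exprMn sqr_root4 rE.
have m0 : 0 <= root4 s * r by rewrite mulr_ge0 ?root4_ge0.
have y1 : xi^-1 < 1 by nra.
have hi : (root4 s * r) ^+ 2 < 1.
  rewrite m2; apply: (@lt_trans _ _ (Num.sqrt s * xi^-1 ^+ 2)); first by rewrite ltr_pM2l.
  rewrite -[ltRHS](_ : xi ^+ 2 * xi^-1 ^+ 2 = 1); first by rewrite ltr_pM2r ?exprn_gt0.
  by rewrite -exprMn mulrC yx expr1n.
have lo : 1 - xi^-1 < (root4 s * r) ^+ 2.
  rewrite m2; apply: (@lt_trans _ _ ((xi ^+ 2 - xi / 2) * (xi^-1 ^+ 2 * (1 - xi^-1 / 8)))).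
    have -> : (xi ^+ 2 - xi / 2) * (xi^-1 ^+ 2 * (1 - xi^-1 / 8)) =
        (1 - xi^-1 / 2) * (1 - xi^-1 / 8) by field; rewrite gt_eqF.
    by nra.
  apply: (@lt_trans _ _ (Num.sqrt s * (xi^-1 ^+ 2 * (1 - xi^-1 / 8)))).
    by rewrite ltr_pM2r// mulr_gt0 ?exprn_gt0//; lra.
  by rewrite ltr_pM2l.
by apply/andP; split; nra.
Qed.

Lemma squeezed_lt1 c : `|c| <= 1 -> `|r * c * root4 s| < 1 /\ `|r * c / root4 s| < (Num.sqrt s)^-1.
Proof.
move=> c1; have /andP[_ H] := squeezed_radius_bounds; have l1 := root4_sigma_gt1.
have l0 : 0 < root4 s by exact: lt_trans l1.
have r0 : 0 <= r by exact: sqrtr_ge0.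
split.
  rewrite !normrM (ger0_norm r0) (gtr0_norm l0) mulrAC; apply: le_lt_trans H.
  by rewrite [leRHS]mulrC ler_piMr// mulr_ge0// ltW.
rewrite normrM normfV (gtr0_norm l0) ltr_pdivrMr// -sqr_root4 -exprVn expr2 divfK ?gt_eqF//.
rewrite normrM (ger0_norm r0); apply: (@le_lt_trans _ _ r); first by rewrite ler_piMr.
by rewrite -[ltRHS]mul1r ltr_pdivlMr// mulrC.
Qed.

End squeezed_radius.

(** The inner half of lap k can meet the sheared pieces of laps k and k - 1, and |u| must be at most
    this number on both; hence k - 1. It still exceeds 1/xi, so the tent vanishes at the ends of the
    half loop. *)
Definition thickness (k : R) : R := (root4 (k - 1))^-1.

Lemma thickness_gt0 k : 1 < k -> 0 < thickness k.
Proof. by move=> k1; rewrite invr_gt0 root4_gt0// subr_gt0. Qed.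

Lemma inv_lt_thickness k xi : 1 < k -> 0 < xi -> k <= xi ^+ 4 -> xi^-1 < thickness k.
Proof.
move=> k1 x0 kx; rewrite ltf_pV2 ?posrE ?root4_gt0 ?subr_gt0//.
rewrite -[ltRHS]root4_exp ?ltW// root4_lt ?exprn_gt0//.
by rewrite ltrBlDr (le_lt_trans kx)// ltrDl.
Qed.

Lemma thickness_le k xi : 24 < xi -> xi ^+ 4 - 2 <= k - 1 -> thickness k <= 2 / xi.
Proof.
move=> x24 H; have x0 : 0 < xi by rewrite (lt_trans _ x24).
have x4 : 24 < xi ^+ 4.
  have x2 : 24 < xi ^+ 2 by nra.
  by rewrite (_ : xi ^+ 4 = xi ^+ 2 * xi ^+ 2); [nra|ring].
have xk : (xi / 2) ^+ 4 <= k - 1 by apply: le_trans H; rewrite expr_div_n -natrX; lra.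
rewrite -[2 / xi]invf_div lef_pV2 ?posrE ?divr_gt0//.
  by rewrite -[leLHS]root4_exp ?root4_le// divr_ge0 ?ltW.
by rewrite root4_gt0// (lt_le_trans _ xk)// exprn_gt0 ?divr_gt0.
Qed.

Lemma periodic_int (f : R -> R) (T : R) : periodic f T ->
  forall i x, f (x + i%:~R * T) = f x.
Proof.
move=> fT; case=> m x; first by rewrite -pmulrn mulr_natl periodicn.
by rewrite NegzE mulrNz mulNr -pmulrn mulr_natl -[in RHS](subrK (T *+ m.+1) x) periodicn.
Qed.

Lemma cosD2piz i x : cos (x + i%:~R * (2 * pi)) = cos x :> R.
Proof. by rewrite (mulr_natl pi 2) (periodic_int (@cosD2pi R)). Qed.

Lemma sinD2piz i x : sin (x + i%:~R * (2 * pi)) = sin x :> R.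
Proof. by rewrite (mulr_natl pi 2) (periodic_int (@sinD2pi R)). Qed.

(** Reduce the difference to z in [0, 2 pi); then cos z = 1 excludes sin (z/2) > 0. *)
Lemma cos_sin_inj x y : cos x = cos y -> sin x = sin y ->
  exists i, x - y = i%:~R * (2 * pi).
Proof.
move=> cxy sxy; pose T : R := 2 * pi.
have T0 : 0 < T by rewrite mulr_gt0 ?pi_gt0.
pose i := Num.floor ((x - y) / T).
have /andP[i1 i2] := floor_itv ((x - y) / T); rewrite -/i in i1 i2.
exists i; set z := x - y - i%:~R * T.
suff z0 : z = 0 by apply/eqP; rewrite -subr_eq0; apply/eqP.
have z1 : 0 <= z by rewrite subr_ge0 -ler_pdivlMr.
have z2 : z < T.
  by move: i2; rewrite ltr_pdivrMr// rmorphD /= mulrDl mul1r /z; lra.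
have : cos z = 1.
  rewrite /z -mulNr -mulrNz cosD2piz cosB cxy sxy -!expr2 cos2Dsin2//.
apply: contra_eq => zN; rewrite lt_eqF//.
have -> : z = (z / 2) *+ 2 by rewrite -mulr_natr divfK.
rewrite cos_mulr2n.
have : 0 < sin (z / 2).
  by apply: sin_gt0_pi; rewrite /T in z2; move: zN; rewrite neq_lt ltNge z1 /= => z3; lra.
have := cos2Dsin2 (z / 2); rewrite mulr2n; nra.
Qed.

Lemma polar_inj x y (c s : R) : 0 < x -> 0 < y ->
  Num.sqrt x * cos c = Num.sqrt y * cos s -> Num.sqrt x * sin c = Num.sqrt y * sin s ->
  x = y /\ exists i, c - s = i%:~R * (2 * pi).
Proof.
move=> x0 y0 Hc Hs.
have xE : x = (Num.sqrt x * cos c) ^+ 2 + (Num.sqrt x * sin c) ^+ 2.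
  by rewrite !exprMn -mulrDr cos2Dsin2 mulr1 sqr_sqrtr// ltW.
have yE : y = (Num.sqrt y * cos s) ^+ 2 + (Num.sqrt y * sin s) ^+ 2.
  by rewrite !exprMn -mulrDr cos2Dsin2 mulr1 sqr_sqrtr// ltW.
have xy : x = y by rewrite xE yE Hc Hs.
have r0 : Num.sqrt x != 0 by rewrite gt_eqF// sqrtr_gt0.
split => //; apply: cos_sin_inj; apply: (mulfI r0).
  by rewrite Hc xy.
by rewrite Hs xy.
Qed.

Lemma small_int i z : `|z| < 1 -> i%:~R = z -> i = 0.
Proof.
move=> z1 iz; move: z1; rewrite -iz -intr_norm (_ : 1 = 1%:~R)// ltr_int.
by rewrite -[X in _ < X]add0r ltzD1 normr_le0 => /eqP.
Qed.

End estimates.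

(** * The embedding *)

Section charts.
Context {R : realType} (n : nat).
Local Notation E := 'rV[R]_(n.*2).
Hypothesis n3 : (3 <= n)%N.
Implicit Types p q : E.

Lemma upd6E p c0 c1 c2 c3 c4 c5 :
  ((coord (upd6 p c0 c1 c2 c3 c4 c5) 0 = c0) *
   (coord (upd6 p c0 c1 c2 c3 c4 c5) 1 = c1) *
   (coord (upd6 p c0 c1 c2 c3 c4 c5) 2 = c2) *
   (coord (upd6 p c0 c1 c2 c3 c4 c5) 3 = c3) *
   (coord (upd6 p c0 c1 c2 c3 c4 c5) 4 = c4) *
   (coord (upd6 p c0 c1 c2 c3 c4 c5) 5 = c5))%type.
Proof.
have n6 k : (k < 6)%N -> (k < n.*2)%N.
  by move=> k6; apply: leq_trans k6 _; rewrite (@leq_double 3).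
by rewrite !coord_upd6 ?n6.
Qed.

Definition same_tail p q := forall k, (6 <= k)%N -> coord p k = coord q k.

Lemma upd6_tail p c0 c1 c2 c3 c4 c5 : same_tail (upd6 p c0 c1 c2 c3 c4 c5) p.
Proof.
move=> k k6; have [kn|nk] := ltnP k n.*2; last by rewrite !coord_ge.
by rewrite coord_upd6// nth_default.
Qed.

Lemma upd6_same_tail p q c0 c1 c2 c3 c4 c5 d0 d1 d2 d3 d4 d5 :
  upd6 p c0 c1 c2 c3 c4 c5 = upd6 q d0 d1 d2 d3 d4 d5 -> same_tail p q.
Proof.
move=> H k k6; have := congr1 (fun z => coord z k) H.
by rewrite /= !upd6_tail.
Qed.

Lemma coord6_inj p q : coord p 0 = coord q 0 -> coord p 1 = coord q 1 ->
  coord p 2 = coord q 2 -> coord p 3 = coord q 3 -> coord p 4 = coord q 4 ->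
  coord p 5 = coord q 5 -> same_tail p q -> p = q.
Proof.
by move=> *; apply: coord_inj => -[|[|[|[|[|[|k]]]]]] //; auto.
Qed.

Ltac upd6_eq H := have := (congr1 (fun z => coord z 0) H, congr1 (fun z => coord z 1) H,
  congr1 (fun z => coord z 2) H, congr1 (fun z => coord z 3) H,
  congr1 (fun z => coord z 4) H, congr1 (fun z => coord z 5) H); rewrite !upd6E.

Lemma to_halfplane_inj : injective (@to_halfplane R n).
Proof.
move=> p q H; have T := upd6_same_tail H; upd6_eq H => -[[[[[H0 H1] H2] H3] H4] H5].
move/expR_inj: H2 => H2; rewrite H2 in H3.
apply: coord6_inj => //; apply: (mulIf _ H3).
by rewrite gt_eqF ?expR_gt0.
Qed.

Lemma jap3_neq0 (y : R) : 2 * jap y ^+ 3 != 0.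
Proof. by rewrite mulf_neq0// expf_neq0// gt_eqF ?jap_gt0. Qed.

Lemma to_halfstrip_inj : injective (@to_halfstrip R n).
Proof.
move=> p q H; have T := upd6_same_tail H; upd6_eq H => -[[[[[H0 H1] H2] H3] H4] H5].
move/addIr/sg_inj: H3 => H3; rewrite H3 in H2.
by apply: coord6_inj => //; apply: (mulIf _ H2); exact: jap3_neq0.
Qed.

Lemma to_strip_inj : injective (@to_strip R n).
Proof.
move=> p q H; have T := upd6_same_tail H; upd6_eq H => -[[[[[H0 H1] H2] H3] H4] H5].
move/sg_inj: H4 => H4; rewrite H4 in H5.
by apply: coord6_inj => //; apply: (mulIf _ H5); exact: jap3_neq0.
Qed.

Lemma twist_norm p :
  coord (twist p) 0 ^+ 2 + coord (twist p) 1 ^+ 2 = coord p 0 ^+ 2 + coord p 1 ^+ 2.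
Proof.
rewrite !upd6E; have := cos2Dsin2 (twist_angle p).
move: (cos _) (sin _) => c s cs.
transitivity ((c ^+ 2 + s ^+ 2) * (coord p 0 ^+ 2 + coord p 1 ^+ 2)); first by ring.
by rewrite cs mul1r.
Qed.

Lemma twist_inj : injective (@twist R n).
Proof.
move=> p q H; have T := upd6_same_tail H.
have A : coord p 0 ^+ 2 + coord p 1 ^+ 2 = coord q 0 ^+ 2 + coord q 1 ^+ 2.
  by rewrite -(twist_norm p) -(twist_norm q) H.
upd6_eq H => -[[[[[H0 H1] H2] H3] H4] H5].
have B : twist_angle p = twist_angle q by rewrite /twist_angle A H3.
rewrite A in H2; move/addIr: H2 => H2; rewrite B in H0 H1.
have := cos2Dsin2 (twist_angle q); move: (cos _) (sin _) H0 H1 => c s H0 H1 cs.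
apply: coord6_inj => //.
- transitivity ((c ^+ 2 + s ^+ 2) * coord p 0); first by rewrite cs mul1r.
  transitivity ((coord p 0 * c - coord p 1 * s) * c + (coord p 0 * s + coord p 1 * c) * s).
    by ring.
  rewrite H0 H1; transitivity ((c ^+ 2 + s ^+ 2) * coord q 0); first by ring.
  by rewrite cs mul1r.
- transitivity ((c ^+ 2 + s ^+ 2) * coord p 1); first by rewrite cs mul1r.
  transitivity ((coord p 0 * s + coord p 1 * c) * c - (coord p 0 * c - coord p 1 * s) * s).
    by ring.
  rewrite H0 H1; transitivity ((c ^+ 2 + s ^+ 2) * coord q 1); first by ring.
  by rewrite cs mul1r.
Qed.

Lemma to_square_inj p q : -1 < coord p 0 < 1 -> -1 < coord q 0 < 1 ->
  to_square p = to_square q -> p = q.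
Proof.
move=> pI qI H; have T := upd6_same_tail H.
upd6_eq H => -[[[[[H0 H1] H2] H3] H4] H5].
have {}H0 := area_inj pI qI H0; rewrite H0 in H1.
apply: coord6_inj => //; apply: (mulIf _ H1).
by rewrite mulf_neq0 ?invr_eq0 ?(gt_eqF (chord_gt0 _))// mulf_neq0// gt_eqF ?pi_gt0.
Qed.

Definition pre p : E := to_square (twist (to_strip (to_halfstrip (to_halfplane p)))).

(** The margin of [a] is at its upper end, the side towards which the tent pushes; that of [b] is
    symmetric, since K'(u) takes both signs. *)
Definition dom q := [/\ 24 < coord q 2, -1 < coord q 3 < 0, 0 < coord q 4 < 1,
  0 < coord q 0 < 1 - 8 / coord q 2 & `|coord q 1| < pi / 2 * (1 - 8 / coord q 2)].

Lemma disc_itv (x y : R) : x ^+ 2 + y ^+ 2 < 1 -> -1 < x < 1.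
Proof. by move=> H; have := sqr_ge0 y => y0; apply/andP; split; nra. Qed.

Let pre3 p : E := to_strip (to_halfstrip (to_halfplane p)).

Let pre3_01 p : coord (pre3 p) 0 = coord p 0 /\ coord (pre3 p) 1 = coord p 1.
Proof. by rewrite /pre3 !upd6E. Qed.

Lemma pre_itv p : cylinder p -> -1 < coord (twist (pre3 p)) 0 < 1.
Proof.
move=> Cp; apply: (@disc_itv _ (coord (twist (pre3 p)) 1)).
by rewrite twist_norm; have [-> ->] := pre3_01 p.
Qed.

Lemma pre_inj p q : cylinder p -> cylinder q -> pre p = pre q -> p = q.
Proof.
move=> Cp Cq /(to_square_inj (pre_itv Cp) (pre_itv Cq)).
by move/twist_inj/to_strip_inj/to_halfstrip_inj/to_halfplane_inj.
Qed.

Lemma symp_pre p : cylinder p -> symp_at pre p.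
Proof.
move=> Cp.
have S3 : symp_at pre3 p.
  apply: (@symp_at_comp _ _ (fun p => to_halfstrip (to_halfplane p)) (@to_strip R n));
    last exact: symp_to_strip.
  by apply: symp_at_comp; [exact: symp_to_halfplane|exact: symp_to_halfstrip].
apply: (@symp_at_comp _ _ (fun p => twist (pre3 p)) (@to_square R n)); last first.
  exact/symp_to_square/pre_itv.
apply: (symp_at_comp S3); apply: symp_twist => //.
by have [-> ->] := pre3_01 p.
Qed.

(** Let h = (1 + |z1|^2)/2. Then x <= h, and |y| / chord x <= |z1| <= h because y^2 = |z1|^2 - x^2
    <= |z1|^2 (1 - x^2). As xi > tau, [tau_bounds] puts both h and area h below 1 - 8/xi. *)
Lemma pre_dom p : cylinder p -> dom (pre p).
Proof.
move=> Cp; have I := pre_itv Cp; rewrite /dom.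
have N := twist_norm (pre3 p).
have A0 : 0 <= coord (pre3 p) 0 ^+ 2 + coord (pre3 p) 1 ^+ 2.
  by rewrite addr_ge0 ?sqr_ge0.
have A1 : coord (pre3 p) 0 ^+ 2 + coord (pre3 p) 1 ^+ 2 < 1.
  by have [-> ->] := pre3_01 p.
have X0 : 0 < coord (pre3 p) 2.
  by rewrite /pre3 !upd6E mulr_gt0 ?expR_gt0// mulr_gt0// exprn_gt0// jap_gt0.
have X : coord (twist (pre3 p)) 2 =
    coord (pre3 p) 2 + tau (coord (pre3 p) 0 ^+ 2 + coord (pre3 p) 1 ^+ 2).
  by rewrite upd6E.
have Tr : -1 < coord (twist (pre3 p)) 3 < 0.
  rewrite !upd6E; have := sg_gt0 (coord p 3 * expR (- coord p 2)).
  by have := sg_lt1 (coord p 3 * expR (- coord p 2)); lra.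
have Sr : 0 < coord (twist (pre3 p)) 4 < 1 by rewrite !upd6E sg_gt0 sg_lt1.
rewrite /pre -/(pre3 p); move: (twist (pre3 p)) I N X Tr Sr => P I N X Tr Sr.
rewrite !upd6E.
have [T1 T2 T3] := @tau_bounds R _ (introT andP (conj A0 A1)).
move: (coord (pre3 p) 0 ^+ 2 + coord (pre3 p) 1 ^+ 2) A0 A1 N X T1 T2 T3 => al A0 A1 N X T1 T2 T3.
have x24 : 24 < coord P 2 by rewrite X; lra.
have x0 : 0 < coord P 2 by rewrite (lt_trans _ x24).
have Ih : -1 < (1 + al) / 2 < 1 by lra.
have aI := area_lt1 Ih.
have B1 : area ((1 + al) / 2) < 1 - 8 / coord P 2.
  rewrite ltrBrDr -ltrBrDl ltr_pdivrMr// X; nra.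
have B2 : (1 + al) / 2 < 1 - 8 / coord P 2.
  rewrite ltrBrDr -ltrBrDl ltr_pdivrMr// X; nra.
split => //.
- rewrite area_gt0//=; apply: le_lt_trans B1.
  have xh : coord P 0 <= (1 + al) / 2 by have := sqr_ge0 (coord P 1); nra.
  move: xh; rewrite le_eqVlt => /predU1P[->//|xh]; rewrite ltW// area_lt//.
    by case/andP: I.
  by case/andP: Ih.
- have c0 := chord_gt0 I.
  rewrite normrM (gtr0_norm (_ : 0 < pi / 2 / chord (coord P 0))); last first.
    by rewrite divr_gt0// divr_gt0 ?pi_gt0.
  rewrite mulrCA ltr_pM2l ?divr_gt0 ?pi_gt0//; apply: le_lt_trans B2.
  rewrite ler_pdivrMr// -ler_sqr ?nnegrE//; last by rewrite mulr_ge0 ?(ltW c0)//; lra.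
  rewrite real_normK ?num_real// exprMn sqr_chord//.
  have := sqr_ge0 (coord P 0); have := sqr_ge0 (coord P 1).
  move: N; move: (coord P 0 ^+ 2) (coord P 1 ^+ 2) => u v N v0 u0.
  have h : al <= ((1 + al) / 2) ^+ 2 by have := sqr_ge0 (1 - al); lra.
  have u1 : 0 <= 1 - u by lra.
  by have := ler_wpM2r u1 h; nra.
Qed.

End charts.

(** * The charts of the half loops and the wrapping map *)

Section wrapping.
Context {R : realType} (n : nat).
Local Notation E := 'rV[R]_(n.*2).
Hypothesis n3 : (3 <= n)%N.
Implicit Types (p q : E) (g dg K dK o : R -> R) (k : R) (T : bool).

Definition coilU q : R :=
  Num.sqrt (rad2 (coord q 2) (coord q 3)) * cos (phase (coord q 2)).
Definition coilV q : R :=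
  - (Num.sqrt (rad2 (coord q 2) (coord q 3)) * sin (phase (coord q 2))).
Definition sigma g q : R := coord q 4 + g (coilU q).
Definition squU g q : R := coilU q * root4 (sigma g q).
Definition shV dg q : R := coilV q - dg (coilU q) * coord q 5.

(** The profiles are arguments, so that near a given point lap and half can be frozen and smoothness
    is a question about fixed functions. *)
Definition chart g dg K dK o q : E :=
  displace K dK o (squeeze (shift_sheet g dg (coil q))).

Definition post g dg K dK o q : E := to_cartesian (chart g dg K dK o q).

Lemma chart0E g dg K dK o q :
  coord (chart g dg K dK o q) 0 = coord q 0 + K (squU g q).
Proof. by rewrite !upd6E. Qed.

Lemma chart1E g dg K dK o q : coord (chart g dg K dK o q) 1 = coord q 1.
Proof. by rewrite !upd6E. Qed.

Lemma chart2E g dg K dK o q : coord (chart g dg K dK o q) 2 = 1 + squU g q.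
Proof. by rewrite !upd6E. Qed.

Lemma chart3E g dg K dK o q : coord (chart g dg K dK o q) 3 =
  shV dg q / root4 (sigma g q) - o (squU g q) - dK (squU g q) * coord q 1.
Proof. by rewrite !upd6E. Qed.

Lemma chart4E g dg K dK o q : coord (chart g dg K dK o q) 4 = sigma g q.
Proof. by rewrite !upd6E. Qed.

Lemma chart5E g dg K dK o q : coord (chart g dg K dK o q) 5 =
  coord q 5 - coilU q * shV dg q / (4 * sigma g q).
Proof. by rewrite !upd6E. Qed.

Lemma chart_tail g dg K dK o q : same_tail (chart g dg K dK o q) q.
Proof. by move=> i i6; rewrite !upd6_tail. Qed.

Lemma chart_congr g dg K dK o h dh L dL l q :
  g (coilU q) = h (coilU q) -> dg (coilU q) = dh (coilU q) ->
  K (squU h q) = L (squU h q) -> dK (squU h q) = dL (squU h q) ->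
  o (squU h q) = l (squU h q) ->
  chart g dg K dK o q = chart h dh L dL l q.
Proof.
move=> Hg Hdg HK HdK Ho.
have Hs : sigma g q = sigma h q by rewrite /sigma Hg.
have Hu : squU g q = squU h q by rewrite /squU Hs.
have Hv : shV dg q = shV dh q by rewrite /shV Hdg.
apply: coord6_inj => //.
- by rewrite !chart0E Hu HK.
- by rewrite !chart1E.
- by rewrite !chart2E Hu.
- by rewrite !chart3E Hs Hu Hv HdK Ho.
- by rewrite !chart4E Hs.
- by rewrite !chart5E Hs Hv.
- by move=> i i6; rewrite !chart_tail.
Qed.

(** The upper bound gives |u| < 1; the lower one makes each loop reach |u| > 1 - 1/xi at its
    tips. *)
Definition sigma_ok g q := coord q 2 ^+ 4 - 3 < sigma g q < coord q 2 ^+ 4.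

Lemma squU_lt1 g q : dom q -> sigma_ok g q -> `|squU g q| < 1.
Proof.
move=> [x24 tI _ _ _] so; rewrite /squU /coilU.
by have [] := squeezed_lt1 x24 tI so (cos_max (phase (coord q 2))).
Qed.

Lemma coilV_lt g q : dom q -> sigma_ok g q ->
  `|coilV q / root4 (sigma g q)| < (Num.sqrt (sigma g q))^-1.
Proof.
move=> [x24 tI _ _ _] so; rewrite /coilV mulNr normrN.
by have [] := squeezed_lt1 x24 tI so (sin_max (phase (coord q 2))).
Qed.

Lemma symp_squeezed g dg q : dom q -> sigma_ok g q ->
  (forall x, D1 x g (dg x)) -> (forall x j, smk j dg x) ->
  symp_at (fun q => squeeze (shift_sheet g dg (coil q))) q.
Proof.
move=> dq so Dg sdg; have [x24 tI _ _ _] := dq.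
have s0 := sigma_gt0 x24 so.
have [r0 _ _] := rad2_bounds x24 tI.
have C1 : symp_at (fun q => shift_sheet g dg (coil q)) q.
  apply: symp_at_comp; first by apply: symp_coil => //; rewrite gt_eqF// (lt_trans _ x24).
  exact: symp_shift_sheet.
apply: (symp_at_comp C1); apply: symp_squeeze => //.
by rewrite !upd6E.
Qed.

Lemma symp_post g dg K dK o q : dom q -> sigma_ok g q ->
  (forall x, D1 x g (dg x)) -> (forall x j, smk j dg x) ->
  (forall x, D1 x K (dK x)) -> (forall x j, smk j dK x) -> (forall x j, smk j o x) ->
  (forall x, 0 <= K x) -> symp_at (post g dg K dK o) q.
Proof.
move=> dq so Dg sdg DK sdK so' K0.
have C := symp_squeezed dq so Dg sdg.
have C1 : symp_at (chart g dg K dK o) q by apply: (symp_at_comp C); exact: symp_displace.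
apply: (symp_at_comp C1); apply: symp_to_cartesian => //.
  rewrite chart0E; have [_ _ _ /andP[a0 _] _] := dq.
  by rewrite ltr_pwDl.
by rewrite chart2E; have := squU_lt1 dq so; rewrite ltr_norml; lra.
Qed.

(** Lap k starts at level k - 2 and ends at k - 1, the initial level of lap k + 1. The offset -2
    keeps [sigma] below xi^4. The scale sqrt k confines the shear to 0 < U < k^(-1/2), which after
    stretching means |u| of order k^(-1/4). *)
Definition sheet k T (U : R) : R :=
  if T then k - 2 else k - 2 + step (Num.sqrt k * U).
Definition dsheet k T (U : R) : R :=
  if T then 0 else Num.sqrt k * dstep (Num.sqrt k * U).
Definition bump k T (u : R) : R := if T then tent (thickness k) u else 0.
Definition dbump k T (u : R) : R := if T then dtent (thickness k) u else 0.
Definition turn k T (u : R) : R := if T then lift_angle (thickness k) u else 0.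

Lemma D1_cst (x c : R) : D1 x (fun=> c) 0.
Proof. by apply: DS_eq (DS_cst x c) _ => u; rewrite mulr0. Qed.

Lemma D1_sheet k T x : D1 x (sheet k T) (dsheet k T x).
Proof.
rewrite /sheet /dsheet; case: T; first exact: D1_cst.
have D := DS_add (DS_cst x (k - 2))
  (DS_comp (DS_mul (DS_cst x (Num.sqrt k)) (D1_id x)) (D1_step _)).
by apply: DS_eq D _ => u /=; ring.
Qed.

Lemma smk_dsheet k T x j : smk j (dsheet k T) x.
Proof.
rewrite /dsheet; case: T; first exact: smk_cst.
apply: smkM; first exact: smk_cst.
apply: (@smk_comp1 _ _ _ dstep (fun U => Num.sqrt k * U)); first exact: smk_dstep.
by apply: smkM; [exact: smk_cst|case: (D1_id x)].
Qed.

Lemma D1_bump k T x : 1 < k -> D1 x (bump k T) (dbump k T x).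
Proof.
move=> k1; rewrite /bump /dbump; case: T; last exact: D1_cst.
exact/D1_tent/thickness_gt0.
Qed.

Lemma smk_dbump k T x j : 1 < k -> smk j (dbump k T) x.
Proof.
move=> k1; rewrite /dbump; case: T; last exact: smk_cst.
exact/smk_dtent/thickness_gt0.
Qed.

Lemma smk_turn k T x j : 1 < k -> smk j (turn k T) x.
Proof.
move=> k1; rewrite /turn; case: T; last exact: smk_cst.
exact/smk_lift_angle/thickness_gt0.
Qed.

Lemma bump_ge0 k T x : 1 < k -> 0 <= bump k T x.
Proof. by move=> k1; rewrite /bump; case: T => //; exact/tent_ge0/thickness_gt0. Qed.

Definition lap q : R := (Num.floor (coord q 2 ^+ 4))%:~R.
(** The first half of a lap, where V <= 0; it carries the tent. On the second half V > 0, and the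
    shear takes place. *)
Definition inner_half q : bool := coord q 2 ^+ 4 <= lap q + 1 / 2.

Definition lap_chart q : E :=
  chart (sheet (lap q) (inner_half q)) (dsheet (lap q) (inner_half q))
    (bump (lap q) (inner_half q)) (dbump (lap q) (inner_half q))
    (turn (lap q) (inner_half q)) q.

Definition wrap q : E := to_cartesian (lap_chart q).

Lemma lap_itv q : lap q <= coord q 2 ^+ 4 < lap q + 1.
Proof. by have := floor_itv (coord q 2 ^+ 4); rewrite rmorphD. Qed.

Lemma dom_xi4 q : dom q -> 24 < coord q 2 ^+ 4.
Proof.
move=> [x24 _ _ _ _]; have x2 : 24 < coord q 2 ^+ 2 by nra.
by rewrite (_ : coord q 2 ^+ 4 = coord q 2 ^+ 2 * coord q 2 ^+ 2); [nra|ring].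
Qed.

Lemma lap_gt1 q : dom q -> 23 < lap q.
Proof. by move=> /dom_xi4 H; have /andP[_] := lap_itv q; lra. Qed.

Lemma sigma_sheet_ok q : dom q -> sigma_ok (sheet (lap q) (inner_half q)) q.
Proof.
move=> [_ _ /andP[s0 s1] _ _]; have /andP[l1 l2] := lap_itv q.
rewrite /sigma_ok /sigma /sheet /inner_half; case: ifPn => [h|].
  by move: h; move: (coord q 2 ^+ 4) (lap q) l1 l2 => X k l1 l2 h; lra.
rewrite -ltNge => h; have S0 := step_ge0 (Num.sqrt (lap q) * coilU q).
have S1 := step_le1 (Num.sqrt (lap q) * coilU q).
move: (step (Num.sqrt (lap q) * coilU q)) S0 S1 => S S0 S1.
by move: (coord q 2 ^+ 4) (lap q) l1 l2 h => X k l1 l2 h; lra.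
Qed.

Lemma wrap_near_post q h dh L dL l :
  (\forall y \near q, lap_chart y = chart h dh L dL l y) ->
  symp_at (post h dh L dL l) q -> symp_at wrap q.
Proof.
move=> H; apply: symp_at_ext; apply: filterS H => y.
by rewrite /wrap => ->.
Qed.

Lemma floor_intP (X : R) (i : int) : i%:~R <= X < i%:~R + 1 -> Num.floor X = i.
Proof. by move=> H; apply: floor_def; rewrite rmorphD. Qed.

Lemma continuous_xi4 q : {for q, continuous (fun y : E => coord y 2 ^+ 4)}.
Proof.
apply: differentiable_continuous; exact: DS_diff (DS_pow 4 (DS_coord q 2)).
Qed.

Lemma continuous_coord (f : E -> E) q j : smv f q ->
  {for q, continuous (fun y => coord (f y) j)}.
Proof.
move=> sf; have cf := differentiable_continuous (smv_diff sf).
exact: (continuous_comp cf (differentiable_continuous (DS_diff (DS_coord (f q) j)))).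
Qed.

Lemma near_itv (h : E -> R) q (a b : R) : {for q, continuous h} -> a < h q < b ->
  \forall y \near q, a < h y < b.
Proof.
move=> ch /andP[ah hb]; near=> y; apply/andP; split; near: y.
  exact: (cvgr_gt _ ch).
exact: (cvgr_lt _ ch).
Unshelve. all: by end_near. Qed.

Lemma phase_lap q (i : int) c : coord q 2 ^+ 4 = i%:~R + c ->
  (cos (phase (coord q 2)) = cos (c * (2 * pi))) *
  (sin (phase (coord q 2)) = sin (c * (2 * pi))).
Proof.
move=> H; rewrite /phase H.
have -> : 2 * pi * (i%:~R + c) = c * (2 * pi) + i%:~R * (2 * pi) :> R by ring.
by rewrite cosD2piz sinD2piz.
Qed.

End wrapping.

(** * The half loops fit together to a smooth symplectic map *)

Section wrapping_symplectic.
Context {R : realType} (n : nat).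
Local Notation E := 'rV[R]_(n.*2).
Hypothesis n3 : (3 <= n)%N.
Implicit Types (p q y : E) (k : R) (T : bool) (i : int).

Lemma lap_floor q i : i%:~R <= coord q 2 ^+ 4 < i%:~R + 1 -> lap q = i%:~R.
Proof. by move=> H; rewrite /lap (floor_intP H). Qed.

(** The chart with constant sheet, no tent and no turn, with which both adjacent halves agree near a
    tip of a loop. *)
Let tip (k : R) : E -> E :=
  chart (fun=> k - 2) (fun=> 0) (fun=> 0) (fun=> 0) (fun=> 0).

Lemma inner_half_tip k q : 1 < k -> 1 - thickness k <= `|squU (fun=> k - 2) q| ->
  chart (sheet k true) (dsheet k true) (bump k true) (dbump k true) (turn k true) q =
  tip k q.
Proof.
move=> k1 H; have [H1 H2 H3] := tent_outside (thickness_gt0 k1) H.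
exact: chart_congr.
Qed.

Lemma outer_half_tip k q : Num.sqrt k * coilU q <= 0 ->
  chart (sheet k false) (dsheet k false) (bump k false) (dbump k false)
    (turn k false) q = tip k q.
Proof.
move=> H; apply: chart_congr => //; first by rewrite /sheet step_le0// addr0.
by rewrite /dsheet dstep_le0// mulr0.
Qed.

Lemma outer_half_next_tip k q : 1 <= Num.sqrt k * coilU q ->
  chart (sheet k false) (dsheet k false) (bump k false) (dbump k false)
    (turn k false) q = tip (k + 1) q.
Proof.
move=> H; apply: chart_congr => //; first by rewrite /sheet step_ge1//; lra.
by rewrite /dsheet dstep_ge1// mulr0.
Qed.

Lemma symp_tip k q : dom q -> sigma_ok (fun=> k - 2) q ->
  symp_at (post (fun=> k - 2) (fun=> 0) (fun=> 0) (fun=> 0) (fun=> 0)) q.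
Proof.
move=> dq so; apply: symp_post => // *; try exact: D1_cst; exact: smk_cst.
Qed.

Lemma squU_continuous k q : dom q -> sigma_ok (fun=> k - 2) q ->
  {for q, continuous (squU (fun=> k - 2))} /\ {for q, continuous (@coilU R n)}.
Proof.
move=> dq so; split.
  have [S _] := @symp_squeezed R n n3 (fun=> k - 2) (fun=> 0) q dq so
    (fun x => D1_cst x _) (fun x j => smk_cst j 0 x).
  have -> : squU (fun=> k - 2) =
      (fun y : E => coord (squeeze (shift_sheet (fun=> k - 2) (fun=> 0) (coil y))) 2).
    by apply/funext => y; rewrite !upd6E.
  exact: continuous_coord.
have -> : @coilU R n = (fun y : E => coord (coil y) 2).
  by apply/funext => y; rewrite !upd6E.
have [x24 tI _ _ _] := dq; have [r0 _ _] := rad2_bounds x24 tI.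
apply: continuous_coord.
have [] // : symp_at (@coil R n) q.
by apply: symp_coil => //; rewrite gt_eqF// (lt_trans _ x24).
Qed.

(** Lap and half are locally constant except at xi^4 = k and xi^4 = k + 1/2. There |cos| = 1, so |u|
    is the full squeezed radius, beyond the support of the tent, and both branches coincide with
    [tip]. *)
Lemma symp_wrap q : dom q -> symp_at (@wrap R n) q.
Proof.
move=> dq; have /andP[l1 l2] := lap_itv q; have k23 := lap_gt1 dq.
have k1 : 1 < lap q by lra.
have [x24 tI /andP[s0 s1] _ _] := dq.
have x0 : 0 < coord q 2 by rewrite (lt_trans _ x24).
set i := Num.floor (coord q 2 ^+ 4).
have iE : lap q = i%:~R by [].
have so := sigma_sheet_ok dq.
have generic T : (\forall y \near q, lap y = lap q /\ inner_half y = T) ->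
    symp_at (@wrap R n) q.
  move=> H; have [_ HT] := nbhs_singleton H.
  apply: (@wrap_near_post _ _ _ (sheet (lap q) T) (dsheet (lap q) T) (bump (lap q) T)
    (dbump (lap q) T) (turn (lap q) T)).
    by apply: filterS H => y [Hl HT']; rewrite /lap_chart Hl HT'.
  rewrite -HT; apply: symp_post => // *; [exact: D1_sheet|exact: smk_dsheet|
    exact: D1_bump|exact: smk_dbump|exact: smk_turn|exact: bump_ge0].
have cX := @continuous_xi4 R n q.
have soN : coord q 2 ^+ 4 <= lap q + 1 / 2 -> sigma_ok (fun=> lap q - 2) q.
  move=> h; rewrite /sigma_ok /sigma.
  by move: (coord q 2 ^+ 4) (lap q) l1 h => X k l1 h; lra.
have rb : coord q 2 ^+ 4 <= lap q + 1 / 2 -> 1 - thickness (lap q) <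
    root4 (sigma (fun=> lap q - 2) q) * Num.sqrt (rad2 (coord q 2) (coord q 3)).
  move=> h; have /andP[H _] := squeezed_radius_bounds x24 tI (soN h).
  apply: lt_trans H; rewrite ltrD2l ltrN2; exact: inv_lt_thickness.
have r0 : 0 < Num.sqrt (rad2 (coord q 2) (coord q 3)).
  by rewrite sqrtr_gt0; have [] := rad2_bounds x24 tI.
(* Passage from lap k - 1 to lap k: U equals the radius, which exceeds (k-1)^(-1/2), so the step of
   lap k - 1 has already reached 1. *)
have [Xi|Xi] := eqVneq (coord q 2 ^+ 4) (lap q).
  have h : coord q 2 ^+ 4 <= lap q + 1 / 2 by rewrite Xi; lra.
  have [cu cU] := squU_continuous dq (soN h).
  have [Hc _] := @phase_lap R n q i 0 ltac:(by rewrite addr0 Xi iE).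
  rewrite mul0r cos0 in Hc.
  have UE : coilU q = Num.sqrt (rad2 (coord q 2) (coord q 3)) by rewrite /coilU Hc mulr1.
  apply: (wrap_near_post (h := fun=> lap q - 2) (dh := fun=> 0) (L := fun=> 0)
    (dL := fun=> 0) (l := fun=> 0)); last exact: symp_tip (soN h).
  have N1 : \forall y \near q, lap q - 1 / 4 < coord y 2 ^+ 4 < lap q + 1 / 4.
    by apply: (near_itv cX); rewrite Xi; lra.
  have N2 : \forall y \near q, 1 - thickness (lap q) < squU (fun=> lap q - 2) y.
    apply: (cvgr_gt _ cu); rewrite /squU UE mulrC; exact: rb.
  have N3 : \forall y \near q, (Num.sqrt (lap q - 1))^-1 < coilU y.
    apply: (cvgr_gt _ cU); rewrite UE -sqrtrV ?subr_ge0 ?(ltW k1)// ltr_sqrt; last first.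
      by have [] := rad2_bounds x24 tI.
    have [_ _ Hr] := rad2_bounds x24 tI; apply: lt_trans Hr.
    rewrite -Xi; set xi := coord q 2 in x24 x0 *.
    have y0 : 0 < xi^-1 by rewrite invr_gt0.
    have yx : xi^-1 * xi = 1 by rewrite mulVf ?gt_eqF.
    have y1 : xi^-1 < 1 by nra.
    have x2 : 24 < xi ^+ 2 by nra.
    have D0 : 0 < xi ^+ 4 - 1.
      by rewrite (_ : xi ^+ 4 = xi ^+ 2 * xi ^+ 2); [nra|ring].
    rewrite -[ltLHS]mul1r ltr_pdivrMr//.
    have -> : xi^-1 ^+ 2 * (1 - xi^-1 / 8) * (xi ^+ 4 - 1) =
        (1 - xi^-1 / 8) * (xi ^+ 2 - xi^-1 ^+ 2) by field; rewrite gt_eqF.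
    have yy : xi^-1 ^+ 2 < 1 by nra.
    by move: (xi ^+ 2) (xi^-1 ^+ 2) x2 yy => a b; nra.
  near=> y.
  have /andP[Y1 Y2] : lap q - 1 / 4 < coord y 2 ^+ 4 < lap q + 1 / 4 by near: y.
  have [Yk|Yk] := leP (lap q) (coord y 2 ^+ 4).
    have Ly : lap y = lap q by rewrite iE; apply: lap_floor; rewrite -iE; lra.
    have Hy : inner_half y = true by rewrite /inner_half Ly; lra.
    rewrite /lap_chart Ly Hy; apply: inner_half_tip => //.
    have : 1 - thickness (lap q) < squU (fun=> lap q - 2) y by near: y.
    by move=> /ltW H; rewrite (le_trans H)// ler_norm.
  have Ly : lap y = lap q - 1.
    by rewrite iE -(rmorphB _ i 1); apply: lap_floor; rewrite rmorphB /= -iE; lra.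
  have Hy : inner_half y = false by rewrite /inner_half Ly; lra.
  rewrite /lap_chart Ly Hy outer_half_next_tip ?subrK//.
  have : (Num.sqrt (lap q - 1))^-1 < coilU y by near: y.
  move=> /ltW; rewrite -(@ler_pM2l _ (Num.sqrt (lap q - 1))) ?sqrtr_gt0 ?subr_gt0//.
  by rewrite divff// gt_eqF// sqrtr_gt0 subr_gt0.
have Xk : lap q < coord q 2 ^+ 4 by rewrite lt_neqAle eq_sym Xi.
have [h|h|h] := ltgtP (coord q 2 ^+ 4) (lap q + 1 / 2).
- apply: (generic true).
  have N1 : \forall y \near q, lap q < coord y 2 ^+ 4 < lap q + 1 / 2.
    by apply: (near_itv cX); rewrite Xk.
  apply: filterS N1 => y /andP[Y1 Y2].
  have Ly : lap y = lap q by rewrite iE; apply: lap_floor; rewrite -iE; lra.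
  by split => //; rewrite /inner_half Ly ltW.
- apply: (generic false).
  have N1 : \forall y \near q, lap q + 1 / 2 < coord y 2 ^+ 4 < lap q + 1.
    by apply: (near_itv cX); rewrite h.
  apply: filterS N1 => y /andP[Y1 Y2].
  have Ly : lap y = lap q by rewrite iE; apply: lap_floor; rewrite -iE; lra.
  by split => //; rewrite /inner_half Ly leNgt Y1.
(* Middle of a lap: the phase is pi, U is negative and the step has not begun. *)
have h' : coord q 2 ^+ 4 <= lap q + 1 / 2 by rewrite h.
have [cu cU] := squU_continuous dq (soN h').
have [Hc _] := @phase_lap R n q i (1 / 2) ltac:(by rewrite h iE).
have cE : 1 / 2 * (2 * pi) = pi :> R by field.
rewrite cE cospi in Hc.
have UE : coilU q = - Num.sqrt (rad2 (coord q 2) (coord q 3)) by rewrite /coilU Hc mulrN1.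
apply: (wrap_near_post (h := fun=> lap q - 2) (dh := fun=> 0) (L := fun=> 0)
  (dL := fun=> 0) (l := fun=> 0)); last exact: symp_tip (soN h').
have N1 : \forall y \near q, lap q + 1 / 4 < coord y 2 ^+ 4 < lap q + 3 / 4.
  by apply: (near_itv cX); rewrite h; lra.
have N2 : \forall y \near q, squU (fun=> lap q - 2) y < - (1 - thickness (lap q)).
  apply: (cvgr_lt _ cu); rewrite /squU UE mulNr ltrN2 mulrC; exact: rb.
have N3 : \forall y \near q, coilU y < 0.
  by apply: (cvgr_lt _ cU); rewrite UE oppr_lt0.
near=> y.
have /andP[Y1 Y2] : lap q + 1 / 4 < coord y 2 ^+ 4 < lap q + 3 / 4 by near: y.
have Ly : lap y = lap q by rewrite iE; apply: lap_floor; rewrite -iE; lra.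
rewrite /lap_chart Ly; case: (inner_half y).
  apply: inner_half_tip => //.
  have : squU (fun=> lap q - 2) y < - (1 - thickness (lap q)) by near: y.
  by rewrite ltrNr => /ltW H; rewrite (le_trans H)// -normrN ler_norm.
apply: outer_half_tip; rewrite mulr_ge0_le0 ?sqrtr_ge0//.
by apply: ltW; near: y.
Unshelve. all: by end_near. Qed.

End wrapping_symplectic.

(** * The image, and the separation of inner from outer halves *)

Section wrapping_injective.
Context {R : realType} (n : nat).
Local Notation E := 'rV[R]_(n.*2).
Hypothesis n3 : (3 <= n)%N.
Implicit Types (p q : E) (k : R) (T : bool) (i : int).

Local Notation gl q := (sheet (lap q) (inner_half q)).
Local Notation dgl q := (dsheet (lap q) (inner_half q)).

Lemma to_cartesianE p :
  ((coord (to_cartesian p) 0 = (Num.sqrt (coord p 0) * cos (2 * coord p 1))%R) *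
   (coord (to_cartesian p) 1 = (Num.sqrt (coord p 0) * sin (2 * coord p 1))%R) *
   (coord (to_cartesian p) 2 = (Num.sqrt (coord p 2) * cos (2 * coord p 3))%R) *
   (coord (to_cartesian p) 3 = (Num.sqrt (coord p 2) * sin (2 * coord p 3))%R) *
   (coord (to_cartesian p) 4 = coord p 4) *
   (coord (to_cartesian p) 5 = coord p 5))%type.
Proof. by rewrite /to_cartesian !upd6E. Qed.

Lemma wrap_pos q : dom q ->
  0 < coord (lap_chart q) 0 /\ 0 < coord (lap_chart q) 2.
Proof.
move=> dq; rewrite /lap_chart chart0E// chart2E//.
have k1 : 1 < lap q by have := lap_gt1 dq; lra.
have := squU_lt1 dq (sigma_sheet_ok dq); rewrite ltr_norml => /andP[u1 _].
have [_ _ _ /andP[a0 _] _] := dq.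
by split; [rewrite ltr_pwDl ?bump_ge0|lra].
Qed.

(** The sum of squares is A1 + A2 = (a + K(u)) + (1 + u), with a < 1 and K(u) <= 1 - |u|. *)
Lemma wrap_image q (Rad : R) : dom q -> Num.sqrt 3 <= Rad -> ball4_prod Rad (wrap q).
Proof.
move=> dq HR; have [A1 A2] := wrap_pos dq.
have R3 : 3 <= Rad ^+ 2.
  have s3 : 0 <= Num.sqrt (3 : R) by exact: sqrtr_ge0.
  have : Num.sqrt 3 ^+ 2 = 3 :> R by rewrite sqr_sqrtr.
  by nra.
rewrite /ball4_prod /= /wrap !to_cartesianE// !exprMn !sqr_sqrtr ?ltW//.
rewrite -addrA -mulrDr -mulrDr !cos2Dsin2 !mulr1; apply: lt_le_trans R3.
have so := sigma_sheet_ok dq; have u1 := squU_lt1 dq so.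
have k1 : 1 < lap q by have := lap_gt1 dq; lra.
rewrite /lap_chart chart0E// chart2E//.
have [x24 _ _ /andP[a0 a1] _] := dq.
have a2 : coord q 0 < 1.
  by apply: lt_trans a1 _; rewrite gtrBl divr_gt0// (lt_trans _ x24).
have B : bump (lap q) (inner_half q) (squU (gl q) q) <= 1 - `|squU (gl q) q|.
  move: (squU (gl q) q) u1 => u u1; rewrite /bump; case: ifP => _; last by rewrite subr_ge0 ltW.
  by apply: tent_le (ltW u1); exact: thickness_gt0.
by have := ler_norm (squU (gl q) q); lra.
Qed.

Lemma lap_ltP q q' : lap q < lap q' -> lap q + 1 <= lap q'.
Proof. by rewrite /lap ltr_int -lezD1 -(ler_int R) rmorphD. Qed.

Lemma lap_lt2P q q' : lap q < lap q' + 2 -> lap q <= lap q' + 1.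
Proof.
rewrite /lap -(rmorphD _ _ 1) (_ : _ + 2 = (Num.floor (coord q' 2 ^+ 4) + 1 + 1)%:~R).
  by rewrite ltr_int ler_int ltzD1.
by rewrite !rmorphD /= -addrA.
Qed.

Lemma lap_close q q' : lap q - lap q' < 1 -> lap q' - lap q < 1 -> lap q = lap q'.
Proof.
move=> H1 H2; case: (ltgtP (lap q) (lap q')) => // /lap_ltP; lra.
Qed.

(** Inside one lap, values of xi^4 with the same phase modulo 2 pi differ by an integer of absolute
    value below 1, so [xi] is determined; then [rad2], affine in t, determines t. *)
Lemma coil_inj q q' : dom q -> dom q' -> lap q = lap q' ->
  inner_half q = inner_half q' -> coilU q = coilU q' -> coilV q = coilV q' ->
  coord q 2 = coord q' 2 /\ coord q 3 = coord q' 3.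
Proof.
move=> [x24 tI _ _ _] [x24' tI' _ _ _] Hl Hh HU /oppr_inj HV.
have [r0 _ _] := rad2_bounds x24 tI; have [r0' _ _] := rad2_bounds x24' tI'.
have [Hr [i Hi]] := polar_inj r0 r0' HU HV.
have x0 : 0 < coord q 2 by rewrite (lt_trans _ x24).
have x0' : 0 < coord q' 2 by rewrite (lt_trans _ x24').
have p0 : (0 : R) < 2 * pi by rewrite mulr_gt0 ?pi_gt0.
have iE : i%:~R = coord q 2 ^+ 4 - coord q' 2 ^+ 4.
  apply: (mulIf (lt0r_neq0 p0)); rewrite -Hi /phase; ring.
have /andP[L1 L2] := lap_itv q; have /andP[L1' L2'] := lap_itv q'.
have i0 : i = 0.
  apply: (small_int (R := R) _ iE).
  by rewrite ltr_norml -Hl in L1' L2' *; lra.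
have X4 : coord q 2 ^+ 4 = coord q' 2 ^+ 4 by apply/eqP; rewrite -subr_eq0 -iE i0.
have X : coord q 2 = coord q' 2.
  by rewrite -[LHS]root4_exp ?(ltW x0)// X4 root4_exp// ltW.
split => //; move: Hr; rewrite /rad2 X => /addrI.
have y0 : (coord q' 2)^-1 ^+ 3 != 0 by rewrite expf_neq0// invr_eq0 gt_eqF.
move/(mulIf y0); apply: mulIf.
by rewrite invr_eq0 mulf_neq0// gt_eqF ?pi_gt0.
Qed.

Lemma coilV_sign q : dom q -> if inner_half q then coilV q <= 0 else 0 < coilV q.
Proof.
move=> [x24 tI _ _ _]; have [r0 _ _] := rad2_bounds x24 tI.
have /andP[L1 L2] := lap_itv q.
have XE : coord q 2 ^+ 4 = (Num.floor (coord q 2 ^+ 4))%:~R + (coord q 2 ^+ 4 - lap q).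
  by rewrite /lap addrC subrK.
have [_ Hs] := phase_lap XE; set c := coord q 2 ^+ 4 - lap q in Hs XE.
have p0 : (0 : R) < pi by exact: pi_gt0.
have R0 : 0 < Num.sqrt (rad2 (coord q 2) (coord q 3)) by rewrite sqrtr_gt0.
rewrite /coilV Hs /inner_half; case: ifPn => [h|].
  rewrite oppr_le0 mulr_ge0 ?(ltW R0)// sin_ge0_pi//.
  have c0 : 0 <= c by rewrite /c; lra.
  have c1 : c <= 1 / 2 by rewrite /c; lra.
  by apply/andP; split; nra.
rewrite -ltNge => h; rewrite -mulrN mulr_gt0//.
have c0 : 1 / 2 < c by rewrite /c; lra.
have c1 : c < 1 by rewrite /c; lra.
have -> : c * (2 * pi) = (c * (2 * pi) - pi) + pi by ring.
rewrite sinDpi opprK sin_gt0_pi//.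
by apply/andP; split; nra.
Qed.

Lemma sigma_inner q : dom q -> inner_half q = true ->
  lap q - 2 < sigma (gl q) q < lap q - 1.
Proof.
move=> [_ _ /andP[s0 s1] _ _] Tq; rewrite /sigma /sheet Tq.
by move: (lap q) => k; lra.
Qed.

Lemma sigma_outer q : dom q -> inner_half q = false ->
  lap q - 2 < sigma (gl q) q < lap q.
Proof.
move=> [_ _ /andP[s0 s1] _ _] Tq; rewrite /sigma /sheet Tq.
have := step_ge0 (Num.sqrt (lap q) * coilU q).
have := step_le1 (Num.sqrt (lap q) * coilU q).
by move: (step (Num.sqrt (lap q) * coilU q)) (lap q) => S k; lra.
Qed.

(** [sigma] lies in (k-2, k-1) on an inner half of lap k and in (k'-2, k') on an outer half of lap
    k'; these intervals meet for only two values of k. *)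
Lemma mixed_laps q q' : dom q -> dom q' -> inner_half q = true ->
  inner_half q' = false -> sigma (gl q) q = sigma (gl q') q' ->
  lap q' <= lap q <= lap q' + 1.
Proof.
move=> dq dq' Tq Tq' Hs; have := sigma_inner dq Tq; rewrite Hs => /andP[h1 h2].
have /andP[h3 h4] := sigma_outer dq' Tq'; move: (sigma _ _) h1 h2 h3 h4 => s h1 h2 h3 h4.
apply/andP; split; last first.
  by apply: lap_lt2P; move: {dq dq' Tq Tq' Hs} (lap q) (lap q') h1 h4 => k k'; lra.
rewrite leNgt; apply/negP => /lap_ltP {dq dq' Tq Tq' Hs}.
by move: (lap q) (lap q') h2 h3 => k k'; lra.
Qed.

(** A non-zero shear forces 0 < U < k'^(-1/2), with k' the lap of [q']. The bound on [a] is 4 *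
    thickness <= 4 * (2/xi), which is where the 8 of [dom] comes from. *)
Lemma sheared_zone q' k s : dom q' -> lap q' <= k <= lap q' + 1 -> 0 < s < lap q' ->
  dsheet (lap q') false (coilU q') != 0 ->
  `|coilU q' * root4 s| <= thickness k /\ coord q' 0 < 1 - 4 * thickness k.
Proof.
move=> dq' /andP[kk kk'] /andP[s0 sk] dst.
have k23 := lap_gt1 dq'; have [x24 _ _ /andP[_ a1] _] := dq'.
have /andP[l1 l2] := lap_itv q'.
have kp : 0 < lap q' by rewrite (lt_trans _ k23).
have [U0 U1] : 0 < coilU q' /\ Num.sqrt (lap q') * coilU q' < 1.
  split; rewrite ltNge; apply: contra_neqN dst => H; rewrite /dsheet.
    by rewrite dstep_le0 ?mulr0// mulr_ge0_le0 ?sqrtr_ge0.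
  by rewrite dstep_ge1// mulr0.
move: (coilU q') (lap q') (coord q' 2) (coord q' 0) kk kk' k23 x24 a1 l1 l2 kp U0 U1 sk
  => U l xi a kk kk' k23 x24 a1 l1 l2 kp U0 U1 sk {dq' dst}.
have Rk : 0 < root4 l by exact: root4_gt0.
split.
  rewrite gtr0_norm; last by rewrite mulr_gt0// root4_gt0.
  apply: (@le_trans _ _ (U * root4 l)); first by rewrite ler_pM2l// root4_le// ltW.
  apply: (@le_trans _ _ (root4 l)^-1).
    rewrite -[leRHS]mul1r ler_pdivlMr// -mulrA -expr2 sqr_root4 mulrC.
    exact: ltW.
  by rewrite lef_pV2 ?posrE ?root4_gt0// ?root4_le// ?subr_gt0; lra.
have th : thickness k <= 2 / xi by apply: thickness_le => //; lra.
apply: lt_le_trans a1 _; rewrite lerD2l lerN2.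
have -> : 8 / xi = 4 * (2 / xi) by rewrite mulrA -natrM.
by rewrite ler_pM2l.
Qed.

(** Here [t] is the added turn and [D] the term K'(u) b. Above, [t] absorbs [D]. Below, t + D <= pi
    - 4 pi/x, which leaves room for |v| + |v'| < 2/x. *)
Lemma mixed_angle (x z v v' t D : R) : 0 < x -> 0 <= t <= pi / 2 -> `|D| <= t ->
  `|D| <= pi / 2 * (1 - 8 / x) -> v <= 0 -> 0 < v' -> - z < v -> v' < z -> z < x^-1 ->
  - pi < v - t - D - v' < 0.
Proof.
move=> x0 /andP[t0 t1]; rewrite !ler_norml => /andP[D1 D2] /andP[D3 D4] v1 v2 v3 v4 zx.
have y0 : 0 < x^-1 by rewrite invr_gt0.
have p2 : (2 : R) <= pi by exact: pi_ge2.
by apply/andP; split; nra.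
Qed.

Lemma int_pi_gap i : - (pi : R) < i%:~R * (pi : R) < 0 -> False.
Proof.
move=> /andP[i1 i2]; have p0 : (0 : R) < pi by exact: pi_gt0.
have i0 : i = 0.
  apply: (small_int (R := R) (z := i%:~R)) => //.
  by rewrite ltr_norml; apply/andP; split; nra.
by move: i2; rewrite i0 mul0r ltxx.
Qed.

Lemma dtent_angle (x e u b : R) : 0 < e -> 0 < x -> `|b| < pi / 2 * (1 - 8 / x) ->
  `|dtent e u * b| <= lift_angle e u /\ `|dtent e u * b| <= pi / 2 * (1 - 8 / x).
Proof.
move=> e0 x0 b1; have d1 := dtent_bound e0 u; have d2 := dtent_le1 e0 u.
have y8 : 0 < 8 / x by rewrite divr_gt0.
have pp : (0 : R) < pi by exact: pi_gt0.
rewrite normrM; split; last first.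
  by apply: le_trans (ltW b1); rewrite ler_piMl.
apply: le_trans d1; rewrite mulrC ler_wpM2r//; apply: le_trans (ltW b1) _.
by rewrite ler_piMr ?divr_ge0 ?pi_ge0// gerBl ltW.
Qed.

Lemma mixed_halves q q' : dom q -> dom q' -> inner_half q = true ->
  inner_half q' = false ->
  coord (lap_chart q) 0 = coord (lap_chart q') 0 -> coord q 1 = coord q' 1 ->
  squU (gl q) q = squU (gl q') q' -> sigma (gl q) q = sigma (gl q') q' ->
  (exists i, coord (lap_chart q) 3 - coord (lap_chart q') 3 = i%:~R * pi) -> False.
Proof.
move=> dq dq' Tq Tq' HA Hb Hu Hs [i Hi].
have so := sigma_sheet_ok dq; have so' := sigma_sheet_ok dq'.
have [x24 _ _ /andP[a0 _] b1] := dq.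
have x0 : 0 < coord q 2 by rewrite (lt_trans _ x24).
have e0 : 0 < thickness (lap q).
  by apply: thickness_gt0; rewrite (lt_trans _ (lap_gt1 dq))// ltr1n.
have sp : 0 < sigma (gl q) q := sigma_gt0 x24 so.
have L0 : 0 < root4 (sigma (gl q) q) by rewrite root4_gt0.
have HU : coilU q = coilU q'.
  by move: Hu; rewrite /squU -Hs; apply: mulIf; rewrite gt_eqF.
(* In the sheared zone the actions differ: a + tent > 1 - 4e on the inner half, and a' < 1 - 4e on
   the outer one. *)
have [dst|dst] := eqVneq (dsheet (lap q') false (coilU q')) 0; last first.
  have sk : 0 < sigma (gl q) q < lap q'.
    by rewrite sp Hs; have /andP[] := sigma_outer dq' Tq'.
  have [ue a1] := sheared_zone dq' (mixed_laps dq dq' Tq Tq' Hs) sk dst.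
  rewrite -HU -/(squU (gl q) q) in ue.
  have te : 1 - 4 * thickness (lap q) <= tent (thickness (lap q)) (squU (gl q) q).
    exact: (@tent_center _ _ e0 _ ue).
  have {}HA : coord q 0 + tent (thickness (lap q)) (squU (gl q) q) = coord q' 0.
    move: HA; rewrite /lap_chart !(chart0E n3).
    by move: (squU (gl q) q) (squU (gl q') q') => u u'; rewrite /bump Tq Tq' addr0.
  rewrite -HA in a1; move: a0 a1 te.
  by move: (tent (thickness (lap q)) (squU (gl q) q)) (thickness (lap q)) (coord q 0)
    => t e a; lra.
(* Without shear the outer angle is just v' > 0, independent of the unbounded coordinate [w], and
   the angles can be compared. *)
have Vs := coilV_sign dq; rewrite Tq in Vs.
have Vs' := coilV_sign dq'; rewrite Tq' in Vs'.
have Vb := coilV_lt dq so; have Vb' := coilV_lt dq' so'; rewrite -Hs in Vb'.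
have E3 : coord (lap_chart q) 3 = coilV q / root4 (sigma (gl q) q) -
    lift_angle (thickness (lap q)) (squU (gl q) q) -
    dtent (thickness (lap q)) (squU (gl q) q) * coord q 1.
  rewrite /lap_chart (chart3E n3) /shV; move: (root4 _) (squU _ _) => l u.
  by rewrite /dsheet /turn /dbump Tq mul0r subr0.
have E3' : coord (lap_chart q') 3 = coilV q' / root4 (sigma (gl q) q).
  rewrite /lap_chart (chart3E n3) -Hs /shV; move: (root4 _) (squU _ _) => l u.
  by rewrite /turn /dbump Tq' dst !mul0r !subr0.
apply: (@int_pi_gap i); rewrite -Hi E3 E3'.
have [d1 d2] := dtent_angle (squU (gl q) q) e0 x0 b1.
move: Vb Vb'; rewrite !ltr_norml => /andP[v3 _] /andP[_ v4].
apply: (mixed_angle x0 _ d1 d2 _ _ v3 v4).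
- exact: lift_angle_bound.
- by rewrite pmulr_lle0 ?invr_gt0.
- exact: divr_gt0.
- by rewrite ltf_pV2 ?posrE ?sqrtr_gt0//; exact: sqrt_sigma_ge x24 so.
Qed.

End wrapping_injective.

(** * Injectivity on halves of the same kind, and the final assembly *)

Section conclusion.
Context {R : realType} (n : nat).
Local Notation E := 'rV[R]_(n.*2).
Hypothesis n3 : (3 <= n)%N.
Implicit Types (p q : E) (i : int).

Local Notation gl q := (sheet (lap q) (inner_half q)).
Local Notation dgl q := (dsheet (lap q) (inner_half q)).

Lemma same_sign_dist (x y l : R) : 0 <= x * y -> `|x| < l -> `|y| < l -> `|x - y| < l.
Proof.
rewrite !ltr_norml => xy /andP[x1 x2] /andP[y1 y2].
by have [?|?] := leP 0 x; have [?|?] := leP 0 y; apply/andP; split; nra.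
Qed.

(** For U >= 0 the step is also nondecreasing in the lap, thanks to the scale sqrt k; for U <= 0
    both steps vanish. A gap of 1 suffices, since [s] varies by less than 1. *)
Lemma outer_sheet_gap q q' : coilU q = coilU q' -> inner_half q = false ->
  inner_half q' = false -> lap q < lap q' -> 0 <= lap q ->
  gl q (coilU q) + 1 <= gl q' (coilU q').
Proof.
move=> HU Tq Tq' kk k0; rewrite /sheet Tq Tq' -HU.
have /lap_ltP k1 := kk.
suff : step (Num.sqrt (lap q) * coilU q) <= step (Num.sqrt (lap q') * coilU q) by lra.
have [U0|U0] := leP 0 (coilU q).
  by apply: step_nondecreasing; rewrite ler_wpM2r// ler_wsqrtr// ltW.
by rewrite !step_le0// mulr_ge0_le0 ?sqrtr_ge0 ?ltW.
Qed.

Lemma int_pi_lt1 i : `|i%:~R| * pi < 1 :> R -> i = 0.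
Proof.
move=> H; apply: (small_int (R := R) (z := i%:~R)) => //.
by have := pi_ge2 R; have := normr_ge0 (i%:~R : R); nra.
Qed.

Lemma eq_mod_pi (x y : R) i :
  `|x| < pi / 2 -> `|y| < pi / 2 -> x - y = i%:~R * pi -> x = y.
Proof.
rewrite !ltr_norml => /andP[x1 x2] /andP[y1 y2] xy.
suff i0 : i = 0 by apply/eqP; rewrite -subr_eq0 xy i0 mul0r.
apply: (small_int (R := R) (z := i%:~R)) => //.
by have := pi_gt0 R; rewrite ltr_norml => p0; apply/andP; split; nra.
Qed.

Lemma dom_angle q : dom q -> `|coord q 1| < pi / 2.
Proof.
move=> [x24 _ _ _ /lt_trans]; apply; rewrite gtr_pMr ?divr_gt0 ?pi_gt0//.
by rewrite gtrBl divr_gt0// (lt_trans _ x24).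
Qed.

(** Polar coordinates return angles modulo pi. This determines [b], confined to an interval of
    length pi, but not theta2, which leaves the integer [i] to be excluded. *)
Lemma wrap_eqP q q' : dom q -> dom q' -> wrap q = wrap q' ->
  [/\ coord (lap_chart q) 0 = coord (lap_chart q') 0,
      coord q 1 = coord q' 1,
      coord (lap_chart q) 2 = coord (lap_chart q') 2 &
      exists i, coord (lap_chart q) 3 - coord (lap_chart q') 3 = i%:~R * pi] /\
  [/\ coord (lap_chart q) 4 = coord (lap_chart q') 4,
      coord (lap_chart q) 5 = coord (lap_chart q') 5 & same_tail q q'].
Proof.
move=> dq dq' H; have [A1 A2] := wrap_pos n3 dq; have [A1' A2'] := wrap_pos n3 dq'.
have two (x y : R) i : 2 * x - 2 * y = i%:~R * (2 * pi) -> x - y = i%:~R * pi.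
  by move=> E2; apply: (@mulfI _ 2) => //; rewrite mulrBr E2 mulrCA.
have C j : coord (wrap q) j = coord (wrap q') j by rewrite H.
have := (C 0%N, C 1%N, C 2%N, C 3%N, C 4%N, C 5%N).
rewrite /wrap !(to_cartesianE n3) => -[[[[[H0 H1] H2] H3] H4] H5].
have [a_eq [i /two bi]] := polar_inj A1 A1' H0 H1.
have [A_eq [j /two thj]] := polar_inj A2 A2' H2 H3.
split; split => //.
- move: bi; rewrite /lap_chart !(chart1E n3).
  exact: eq_mod_pi (dom_angle dq) (dom_angle dq').
- by exists j.
- by move=> k k6; have := C k; rewrite /wrap !upd6_tail.
Qed.

Lemma chart_eqP q q' : coord (lap_chart q) 2 = coord (lap_chart q') 2 ->
  coord (lap_chart q) 4 = coord (lap_chart q') 4 ->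
  squU (gl q) q = squU (gl q') q' /\ sigma (gl q) q = sigma (gl q') q'.
Proof. by rewrite /lap_chart !(chart2E n3) !(chart4E n3) => /addrI. Qed.

Lemma coilV_lt_root q g : dom q -> sigma_ok g q -> `|coilV q| < root4 (sigma g q).
Proof.
move=> dq so; have [x24 _ _ _ _] := dq; have V1 := coilV_lt dq so.
have L1 : 1 < root4 (sigma g q) := root4_sigma_gt1 x24 so.
have L0 : 0 < root4 (sigma g q) by exact: lt_trans L1.
move: V1; rewrite normrM normfV (gtr0_norm L0) ltr_pdivrMr// -sqr_root4.
move/lt_trans; apply; rewrite gtr_pMl// invf_lt1 ?exprn_gt0//.
by rewrite exprn_egt1.
Qed.

Lemma coilU_eq q q' : dom q -> squU (gl q) q = squU (gl q') q' ->
  sigma (gl q) q = sigma (gl q') q' -> coilU q = coilU q'.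
Proof.
move=> dq Hu Hs; have [x24 _ _ _ _] := dq.
have L1 := root4_sigma_gt1 x24 (sigma_sheet_ok dq).
move: Hu; rewrite /squU -Hs; apply: mulIf.
by rewrite gt_eqF// (lt_trans _ L1).
Qed.

Lemma coilV_dist q q' : dom q -> dom q' -> inner_half q = inner_half q' ->
  sigma (gl q) q = sigma (gl q') q' -> `|coilV q - coilV q'| < root4 (sigma (gl q) q).
Proof.
move=> dq dq' HT Hs; have V1 := coilV_lt_root dq (sigma_sheet_ok dq).
have V2 := coilV_lt_root dq' (sigma_sheet_ok dq'); rewrite -Hs in V2.
apply: same_sign_dist V1 V2; have := coilV_sign dq; have := coilV_sign dq'.
by rewrite HT; case: ifP => _ v' v; [exact: mulr_le0|rewrite mulr_ge0 ?ltW].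
Qed.

Section same_half.
Variables q q' : E.
Hypotheses (dq : dom q) (dq' : dom q').
Hypotheses (a_eq : coord (lap_chart q) 0 = coord (lap_chart q') 0)
  (b_eq : coord q 1 = coord q' 1)
  (u_eq : squU (gl q) q = squU (gl q') q')
  (s_eq : sigma (gl q) q = sigma (gl q') q')
  (w_eq : coord (lap_chart q) 5 = coord (lap_chart q') 5)
  (tl : same_tail q q').
Variable i : int.
Hypothesis th_eq : coord (lap_chart q) 3 - coord (lap_chart q') 3 = i%:~R * pi.
Hypothesis T_eq : inner_half q = inner_half q'.

Let U_eq : coilU q = coilU q'. Proof. exact: coilU_eq. Qed.

Let L0 : 0 < root4 (sigma (gl q) q).
Proof.
have [x24 _ _ _ _] := dq.
by rewrite (lt_trans _ (root4_sigma_gt1 x24 (sigma_sheet_ok dq))).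
Qed.

Let s0 : 0 < sigma (gl q) q.
Proof. by have [x24 _ _ _ _] := dq; exact: sigma_gt0 x24 (sigma_sheet_ok dq). Qed.

Let k_eq : lap q = lap q'.
Proof.
have [_ _ /andP[p0 p1] _ _] := dq; have [_ _ /andP[r0 r1] _ _] := dq'.
have k0 : 0 <= lap q by exact: le_trans (ltW (lap_gt1 dq)).
have k0' : 0 <= lap q' by exact: le_trans (ltW (lap_gt1 dq')).
have gap := outer_sheet_gap U_eq; have gap' := outer_sheet_gap (esym U_eq).
have sE := s_eq; rewrite /sigma in sE.
have [Tq|/negbTE Tq] := boolP (inner_half q).
  move: sE; rewrite /sheet -T_eq Tq => sE; apply: lap_close.
    by move: (lap q) (lap q') sE {gap gap' k0 k0'} => k k'; lra.
  by move: (lap q) (lap q') sE {gap gap' k0 k0'} => k k'; lra.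
have Tq' : inner_half q' = false by rewrite -T_eq.
have [kk|kk|//] := ltgtP (lap q) (lap q').
  move: (gap Tq Tq' kk k0) sE => {gap gap'}.
  by move: (gl q (coilU q)) (gl q' (coilU q')) => g g'; lra.
move: (gap' Tq' Tq kk k0') sE => {gap gap'}.
by move: (gl q (coilU q)) (gl q' (coilU q')) => g g'; lra.
Qed.

Let shV_diff : shV (dgl q) q - shV (dgl q') q' = i%:~R * pi * root4 (sigma (gl q) q).
Proof.
rewrite -th_eq /lap_chart !(chart3E n3) -s_eq -u_eq -b_eq -T_eq -k_eq.
move: (turn _ _ _) (dbump _ _ _) (shV _ q) (shV _ q') (coord q 1) L0.
by move: (root4 _) => l o d v v' b l0; field; rewrite gt_eqF.
Qed.

Let w_diff : coord q 5 - coord q' 5 =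
  coilU q * (shV (dgl q) q - shV (dgl q') q') / (4 * sigma (gl q) q).
Proof.
move: w_eq; rewrite /lap_chart !(chart5E n3) -s_eq -U_eq.
move: (shV _ q) (shV _ q') (coord q 5) (coord q' 5) ((4 * _)^-1) => v v' w w' c H.
have -> : w = w' - coilU q * v' * c + coilU q * v * c by rewrite -H; ring.
by ring.
Qed.

Let slope_ge0 : 0 <= dgl q (coilU q) * coilU q.
Proof.
rewrite /dsheet; case: ifP => _; first by rewrite mul0r.
have [U0|U0] := leP 0 (coilU q).
  by rewrite mulr_ge0// mulr_ge0 ?sqrtr_ge0 ?dstep_ge0.
by rewrite dstep_le0 ?mulr0 ?mul0r// mulr_ge0_le0 ?sqrtr_ge0 ?ltW.
Qed.

(* Going once more around the circle moves [w] as well; since the shear has the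
   sign of [U], this can only increase the displacement in [V]. *)
Let V_diff : coilV q - coilV q' = i%:~R * pi * root4 (sigma (gl q) q) *
  (1 + dgl q (coilU q) * coilU q / (4 * sigma (gl q) q)).
Proof.
have -> : coilV q - coilV q' = shV (dgl q) q - shV (dgl q') q' +
    dgl q (coilU q) * (coord q 5 - coord q' 5).
  by rewrite /shV -T_eq -k_eq -U_eq; ring.
by rewrite w_diff shV_diff; ring.
Qed.

(** The displacement in V is below sigma^(1/4) by [coilV_dist], but at least |i| pi sigma^(1/4) by
    [V_diff]. *)
Let i_eq0 : i = 0.
Proof.
apply: int_pi_lt1; have := coilV_dist dq dq' T_eq s_eq.
have F0 : 0 <= dgl q (coilU q) * coilU q / (4 * sigma (gl q) q).
  by rewrite divr_ge0 ?slope_ge0// mulr_ge0// ltW.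
rewrite V_diff !normrM (gtr0_norm (pi_gt0 R)) (gtr0_norm L0).
rewrite [`|1 + _|]ger0_norm; last by rewrite addr_ge0.
rewrite -[X in _ < X]mul1r mulrAC ltr_pM2r//; apply: le_lt_trans.
by rewrite ler_peMr ?lerDl// mulr_ge0 ?pi_ge0.
Qed.

Lemma same_half_inj : q = q'.
Proof.
have V_eq : coilV q = coilV q' by apply/eqP; rewrite -subr_eq0 V_diff i_eq0 !mul0r.
have [x_eq t_eq] := coil_inj dq dq' k_eq T_eq U_eq V_eq.
apply: coord6_inj => //.
- by move: a_eq; rewrite /lap_chart !(chart0E n3) -u_eq -T_eq -k_eq => /addIr.
- by move: s_eq; rewrite /sigma -T_eq -k_eq -U_eq => /addIr.
- by apply/eqP; rewrite -subr_eq0 w_diff shV_diff i_eq0 !mul0r mulr0 mul0r.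
Qed.

End same_half.

Lemma wrap_inj q q' : dom q -> dom q' -> wrap q = wrap q' -> q = q'.
Proof.
move=> dq dq' /(wrap_eqP dq dq')[[a_eq b_eq A_eq [i th_eq]] [s4 w_eq tl]].
have [u_eq s_eq] := chart_eqP A_eq s4.
case Tq : (inner_half q); case Tq' : (inner_half q').
- by apply: (@same_half_inj q q' _ _ _ _ _ _ _ _ i) => //; rewrite Tq.
- by exfalso; apply: (mixed_halves n3 dq dq' Tq Tq') => //; exists i.
- exfalso; apply: (mixed_halves n3 dq' dq Tq' Tq) => //.
  by exists (- i); rewrite mulrNz mulNr -th_eq opprB.
- by apply: (@same_half_inj q q' _ _ _ _ _ _ _ _ i) => //; rewrite Tq.
Qed.

Lemma cylinder_open : open (@cylinder R n).
Proof.
rewrite openE => p Cp; rewrite /interior.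
have D := DS_add (DS_pow 2 (DS_coord p 0)) (DS_pow 2 (DS_coord p 1)).
exact: (cvgr_lt _ (differentiable_continuous (DS_diff D))).
Qed.

End conclusion.

Theorem theorem1p2 (R : realType) (n : nat) (Rad : R) :
  (3 <= n)%N -> Num.sqrt 3 <= Rad ->
  exists f : 'rV[R]_(n.*2) -> 'rV[R]_(n.*2),
    symplectic_embedding (@cylinder R n) (@ball4_prod R n Rad) f.
Proof.
move=> n3 HR; pose f (p : 'rV[R]_(n.*2)) := wrap (pre p).
have sf p : cylinder p -> symp_at f p.
  move=> Cp; apply: (symp_at_comp (symp_pre n3 Cp)).
  exact/(symp_wrap n3)/(pre_dom n3).
have injf p q : cylinder p -> cylinder q -> f p = f q -> p = q.
  move=> Cp Cq /(wrap_inj n3 (pre_dom n3 Cp) (pre_dom n3 Cq)).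
  exact: pre_inj.
exists f; split => //.
- by apply: smv_smooth_on => p /sf[].
- by move=> _ [p Cp <-]; apply: wrap_image => //; exact: pre_dom.
- exact: symp_inverse_continuous (@cylinder_open R n) sf injf.
- by move=> p /sf[].
Qed.
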